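(* Let $W=TT^*$ on $\mathbb{R}$ with $T'=GT$, where $G(z)=\sum_{j=0}^mM_jz^j$ is a matrix polynomial of degree at most $m$, and let $X^n(z)=Y^n(z)V(z)$, all as in the context. Then for every $n\ge0$ the matrix function $X^n$ satisfies $$\frac{d}{dz}X^n(z)=F_n(z;G)X^n(z),\qquad z\in\mathbb{C}\setminus\mathbb{R},$$ where $$F_n(z;G)=\begin{pmatrix}-\mathcal{B}_n(z;G)&-\frac1{2\pi i}\gamma_n^{-1}\mathcal{A}_n(z;G)\\ 2\pi i\,\mathcal{A}_{n-1}(z;G)\gamma_{n-1}&\mathcal{B}_n^*(z;G)\end{pmatrix},$$ and $\mathcal{A}_n$, $\mathcal{B}_n$ are the matrix polynomials $$\mathcal{A}_n(z;G)=-\gamma_n\left(\sum_{j=0}^{m-1}b_{n,n+m-j-1}\Delta_{j,n}^*(z)+\Delta_{j,n}(z)b_{n,n+m-j-1}^*\right),$$ $$\mathcal{B}_n(z;G)=-\left(\sum_{j=0}^{m}\Delta_{j,n}(z)b_{n-1,n+m-j-1}^*+b_{n,n+m-j-2}\Delta_{j,n-1}^*(z)\right)\gamma_{n-1},$$ with $$\Delta_{j,n}(z)=\sum_{k=0}^j\widehat P_{n,k}(z)M_{m-j+k},\qquad \widehat P_{n,k}(z)=z^kI_N+a_{n,n-1}z^{k-1}+\cdots+a_{n,n-k}.$$ Moreover $F_n(\cdot;G)$, defined by these formulas for an arbitrary matrix polynomial in place of $G$, is linear: $F_n(z;G_1+G_2)=F_n(z;G_1)+F_n(z;G_2)$.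
   Context: Fix $N\ge1$. The weight $W:\mathbb{R}\to GL(N,\mathbb{R})$ is smooth, $W(x)$ is (symmetric) positive definite for every $x\in\mathbb{R}$, and all entries of $W$ and $W'$ have finite moments of all orders on $\mathbb{R}$. $A^*$ is the conjugate transpose, $A^{-*}=(A^* )^{-1}$; for matrix functions of a complex variable $F^*(z):=(F(\bar z))^*$. It is assumed that $W(x)=T(x)T^*(x)$ for $x\in\mathbb{R}$, where $T$ is a smooth $N\times N$ matrix-valued function satisfying $T'=GT$ with a matrix polynomial $G$; hence $T$ extends to an entire, everywhere invertible matrix function satisfying $T'(z)=G(z)T(z)$ on $\mathbb{C}$. $\widehat P_n(x)=x^nI_N+\sum_{j=0}^{n-1}a_{n,j}x^j$ is the monic matrix polynomial of degree $n$ with $\int_{\mathbb{R}}\widehat P_n W Q^*dx=0$ for all matrix polynomials $Q$ of degree $\le n-1$; $a_{n,n}=I_N$ and $a_{n,j}=0$ for $j<0$ or $j>n$. $\gamma_n=\big(\int_{\mathbb{R}}\widehat P_nW\widehat P_n^*dx\big)^{-1}$. $b_{n,k}=\int_{\mathbb{R}}x^k\widehat P_n(x)W(x)dx$ for $k\ge n$, and $b_{n,k}=0$ for $k<n$. For $n=0$ the following conventions are used: $\mathcal{B}_0(z;G):=-G(z)$ and $\mathcal{A}_{-1}(z;G)\gamma_{-1}:=0$. $\mathcal{C}(F)(z)=\frac1{2\pi i}\int_{\mathbb{R}}\frac{F(t)}{t-z}dt$. In $N\times N$ blocks, $Y^0(z)=\begin{pmatrix}I_N&\mathcal{C}(W)(z)\\0&I_N\end{pmatrix}$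 and for $n\ge1$ $$Y^n(z)=\begin{pmatrix}\widehat P_n(z)&\mathcal{C}(\widehat P_nW)(z)\\ -2\pi i\gamma_{n-1}\widehat P_{n-1}(z)&-2\pi i\gamma_{n-1}\mathcal{C}(\widehat P_{n-1}W)(z)\end{pmatrix},\quad z\in\mathbb{C}\setminus\mathbb{R}.$$ $V(z)=\begin{pmatrix}T(z)&0\\0&T^{-*}(z)\end{pmatrix}$, where $T^{-*}(z)=(T^*(z))^{-1}$. *)

(* Defs.v *)
From mathcomp Require Import all_boot all_order all_algebra.
From mathcomp Require Import all_classical all_reals all_analysis.
From mathcomp Require Import complex.

Set Implicit Arguments.
Unset Strict Implicit.
Unset Printing Implicit Defensive.

Import Order.TTheory GRing.Theory Num.Theory numFieldNormedType.Exports.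

Local Open Scope classical_set_scope.
Local Open Scope ring_scope.
Local Open Scope sesquilinear_scope.
Local Open Scope complex_scope.

Section MatrixCalculus.
Context {R : realType}.
Local Notation C := R[i].

Definition cint (f : R -> C) : C :=
  (\int[lebesgue_measure]_t complex.Re (f t))%R +i*
  (\int[lebesgue_measure]_t complex.Im (f t))%R.

Definition mxint p q (F : R -> 'M[C]_(p, q)) : 'M[C]_(p, q) :=
  \matrix_(i, j) cint (fun t => F t i j).

(* The complex derivative of F at z exists and equals D. The scalars are
   complex, so the increments in [is_derive] run over a punctured complex
   neighbourhood of 0. *)
Definition mx_is_derive p q (F : C -> 'M[C]_(p, q)) (z : C) (D : 'M[C]_(p, q))
    : Prop :=
  forall i j,
    @is_derive C C^o C^o (z : C^o) (1 : C^o) (fun w => F w i j) (D i j).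

(* F^*(z) := (F (conj z))^*, where ^t* is the conjugate transpose. *)
Definition fstar p q (F : C -> 'M[C]_(p, q)) (z : C) : 'M[C]_(q, p) :=
  (F (Num.conj z)) ^t*.

Definition twopii : C := 0 +i* (2 * pi).

Definition cauchy p q (F : R -> 'M[C]_(p, q)) (z : C) : 'M[C]_(p, q) :=
  twopii^-1 *: mxint (fun t => (t%:C - z)^-1 *: F t).

Definition to_cmx p q (A : 'M[R]_(p, q)) : 'M[C]_(p, q) :=
  map_mx (real_complex R) A.

End MatrixCalculus.

Section Weight.
Context {R : realType} {N : nat}.
Local Notation C := R[i].
Local Notation mu := (@lebesgue_measure R).

Definition posdef (A : 'M[R]_N.+1) : Prop :=
  A^T = A /\
  forall v : 'rV[R]_N.+1, v != 0 -> 0 < (v *m A *m v^T) ord0 ord0.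

Definition smooth (f : R -> R) : Prop :=
  forall (n : nat) (x : R), derivable (derive1n n f) x 1.

Definition finite_moments (f : R -> R) : Prop :=
  forall k : nat, mu.-integrable setT (fun x => (x ^+ k * f x)%:E).

(* Invertibility of W x follows from positive definiteness. *)
Record is_weight (W : R -> 'M[R]_N.+1) : Prop := IsWeight {
  weight_smooth : forall i j, smooth (fun x => W x i j);
  weight_posdef : forall x, posdef (W x);
  weight_moments : forall i j, finite_moments (fun x => W x i j);
  weight_deriv_moments : forall i j, finite_moments (derive1 (fun x => W x i j))
}.

(* A matrix polynomial with coefficients M_j is p : {poly 'M_N.+1} with
   p`_j = M_j; its value at the scalar z is p.[z%:M]. *)
Definition peval (p : {poly 'M[C]_N.+1}) (z : C) : 'M[C]_N.+1 := p.[z%:M].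

Definition monic_OP (W : R -> 'M[R]_N.+1) (P : nat -> {poly 'M[C]_N.+1})
    : Prop :=
  forall n : nat,
    [/\ P n \is monic,
        size (P n) = n.+1 &
        forall Q : {poly 'M[C]_N.+1}, (size Q <= n)%N ->
          mxint (fun x => peval (P n) x%:C *m to_cmx (W x)
                          *m (peval Q x%:C) ^t*) = 0].

End Weight.

Section LadderMatrices.
Context {R : realType} {N : nat}.
Local Notation C := R[i].
Variables (W : R -> 'M[R]_N.+1) (P : nat -> {poly 'M[C]_N.+1}).

Definition gam (n : nat) : 'M[C]_N.+1 :=
  invmx (mxint (fun x => peval (P n) x%:C *m to_cmx (W x)
                         *m (peval (P n) x%:C) ^t*)).

Definition bcoef (n k : nat) : 'M[C]_N.+1 :=
  if (n <= k)%N
  then mxint (fun x => x%:C ^+ k *: (peval (P n) x%:C *m to_cmx (W x)))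
  else 0.

(* \hat P_{n,k}; the guard i <= n implements a_{n,j} = 0 for j < 0, and the
   term i = 0 is z^k I since P n is monic of degree n. *)
Definition Ptrunc (n k : nat) (z : C) : 'M[C]_N.+1 :=
  \sum_(i < k.+1 | (i <= n)%N) z ^+ (k - i) *: (P n)`_(n - i).

Section DegreeBound.
Variables (m : nat) (G : {poly 'M[C]_N.+1}).

Definition Delta (j n : nat) (z : C) : 'M[C]_N.+1 :=
  \sum_(k < j.+1) Ptrunc n k z *m G`_(m - j + k).

Definition calA (n : nat) (z : C) : 'M[C]_N.+1 :=
  - gam n *m (\sum_(j < m)
      (bcoef n (n + m - j - 1) *m fstar (Delta j n) z
       + Delta j n z *m (bcoef n (n + m - j - 1)) ^t*)).

(* The truncated index n + m - j - 2 differs from the integer one only for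
   n = 1, j = m, where the integer index is -1; in both readings the
   coefficient is zero because the index is smaller than n. *)
Definition calB (n : nat) (z : C) : 'M[C]_N.+1 :=
  if n is n'.+1 then
    - (\sum_(j < m.+1)
         (Delta j n z *m (bcoef n' (n + m - j - 1)) ^t*
          + bcoef n (n + m - j - 2) *m fstar (Delta j n') z)) *m gam n'
  else - peval G z.

(* Convention: the product A_{-1} gamma_{-1} is 0. *)
Definition calAgam_pred (n : nat) (z : C) : 'M[C]_N.+1 :=
  if n is n'.+1 then calA n' z *m gam n' else 0.

Definition Fmx (n : nat) (z : C) : 'M[C]_(N.+1 + N.+1) :=
  block_mx (- calB n z)
           (- (twopii^-1 *: (invmx (gam n) *m calA n z)))
           (twopii *: calAgam_pred n z)
           (fstar (calB n) z).

End DegreeBound.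

(* cauchy is a junk value on the real axis, so Ymx is meaningful only for
   nonreal z. *)
Definition Ymx (n : nat) (z : C) : 'M[C]_(N.+1 + N.+1) :=
  let PW k := fun x : R => peval (P k) x%:C *m to_cmx (W x) in
  if n is n'.+1 then
    block_mx (peval (P n) z)
             (cauchy (PW n) z)
             (- (twopii *: (gam n' *m peval (P n') z)))
             (- (twopii *: (gam n' *m cauchy (PW n') z)))
  else block_mx 1%:M (cauchy (fun x => to_cmx (W x)) z) 0 1%:M.

Definition Xmx (T : C -> 'M[C]_N.+1) (n : nat) (z : C)
    : 'M[C]_(N.+1 + N.+1) :=
  Ymx n z *m block_mx (T z) 0 0 (invmx (fstar T z)).

End LadderMatrices.

(* Main.v *)
(* Write Q(U) := U G for a matrix polynomial U, and let DQ(U; z, t) be the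
   difference quotient (Q(U)(z) - Q(U)(t)) / (z - t), a polynomial in t. The
   coefficients of DQ(P_n) in t are exactly the Delta_{j,n}(z), so the sums
   defining A_n and B_n are the integrals
     H(U, V)(z) = int DQ(U; z, .) W V^* + int U W DQ(V; conj z, .)^*,
   namely A_n = - gamma_n H(P_n, P_n) and B_n = - H(P_n, P_{n-1}) gamma_{n-1}.
   Each block of the differential equation then reads, for U = P_n or P_{n-1},
     psi(U) = H(U, P_{n-1}) gamma_{n-1} phi(P_n)
              - H(U, P_n) gamma_{n-1} phi(P_{n-1}),
   where (phi(U), psi(U)) is (U, U' + U G) in the first column and
   (q, q' - q G^* ), with q the Cauchy integral of U W, in the second. By the
   Christoffel-Darboux formula, P_{n-1}^*(s) gamma_{n-1} phi(P_n)
   - P_n^*(s) gamma_{n-1} phi(P_{n-1}) = eps + (z - s) K(s), with K a polynomial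
   of degree < n in s and eps = 0 or 1, so the denominators z - s cancel in the
   right-hand side; what remains is evaluated by integrating by parts with
   W' = G W + W G^* and by the reproducing property of the Christoffel-Darboux
   kernel. *)
Require Import Defs.
From mathcomp Require Import all_boot all_order all_algebra.
From mathcomp Require Import all_classical all_reals all_analysis.
From mathcomp Require Import measurable_realfun complex ring lra.
Import Order.TTheory GRing.Theory Num.Theory numFieldNormedType.Exports.
Local Open Scope ring_scope.
Local Open Scope sesquilinear_scope.
Local Open Scope complex_scope.

(** * Integrals of complex matrix functions *)

Section ComplexIntegral.
Local Set Implicit Arguments.
Local Unset Strict Implicit.
Context {R : realType}.
Local Notation C := R[i].
Local Notation mu := (@lebesgue_measure R).

(** No decay of [W] is given, so the vanishing of boundary terms has to come from the moments. All
    integrands are therefore kept in one class, g(t) U(t) W(t) V(t) with polynomials [U], [V] and a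
    scalar [g] that is differentiable and bounded along the real axis: its members are integrable,
    and it is stable under multiplication by t, which is what [Rintegral_derive_line] needs. The
    choice g = 1 gives the pairing and g(t) = 1/(t - z) the Cauchy integrals, so one integration by
    parts serves both columns. The relation W' = G W + W G^* comes from complex derivatives: on the
    axis [W] is the restriction of T(z) T^*(z). Invertibility of [T] is derived from positive
    definiteness at the point 0 and uniqueness for y' = G y. The constant eps is 0 in the polynomial
    column and 1 in the Cauchy column, where it is the integral of the Christoffel-Darboux kernel
    against [W]. For n = 0 there is no predecessor, and P_0 = 1 is used with K = 0. Additivity
    involves three degree bounds, so F_n is shown to be the same for every admissible bound. *)

Definition cintegrable (f : R -> C) : Prop :=
  mu.-integrable setT (EFin \o (fun t => complex.Re (f t))) /\
  mu.-integrable setT (EFin \o (fun t => complex.Im (f t))).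

Lemma complex_ReD (x y : C) :
  complex.Re (x + y) = complex.Re x + complex.Re y.
Proof. by case: x y => ? ? [? ?]. Qed.

Lemma complex_ImD (x y : C) :
  complex.Im (x + y) = complex.Im x + complex.Im y.
Proof. by case: x y => ? ? [? ?]. Qed.

Lemma complex_ReM (x y : C) : complex.Re (x * y) =
  complex.Re x * complex.Re y - complex.Im x * complex.Im y.
Proof. by case: x y => ? ? [? ?]. Qed.

Lemma complex_ImM (x y : C) : complex.Im (x * y) =
  complex.Re x * complex.Im y + complex.Im x * complex.Re y.
Proof. by case: x y => ? ? [? ?]. Qed.

Lemma complex_eqP (x y : C) :
  complex.Re x = complex.Re y -> complex.Im x = complex.Im y -> x = y.
Proof. by case: x y => ? ? [? ?] /= -> ->. Qed.

Lemma integrable_EFinD (f g : R -> R) :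
  mu.-integrable setT (EFin \o f) -> mu.-integrable setT (EFin \o g) ->
  mu.-integrable setT (EFin \o (fun t => f t + g t)).
Proof.
move=> hf hg.
have -> : EFin \o (fun t => f t + g t) = ((EFin \o f) \+ (EFin \o g))%E by [].
exact: integrableD.
Qed.

Lemma integrable_EFinZl (c : R) (f : R -> R) :
  mu.-integrable setT (EFin \o f) ->
  mu.-integrable setT (EFin \o (fun t => c * f t)).
Proof.
move=> hf.
have -> : EFin \o (fun t => c * f t) = (fun x => c%:E * (EFin \o f) x)%E by [].
exact: integrableZl.
Qed.

Lemma eq_mxint p q (F G : R -> 'M[C]_(p, q)) :
  (forall t, F t = G t) -> mxint F = mxint G.
Proof. by move=> /funext ->. Qed.

Lemma cintegrableD (f g : R -> C) : cintegrable f -> cintegrable g ->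
  cintegrable (fun t => f t + g t).
Proof.
move=> [fr fi] [gr gi]; split.
- under [X in EFin \o X]eq_fun do rewrite complex_ReD; exact: integrable_EFinD.
- under [X in EFin \o X]eq_fun do rewrite complex_ImD; exact: integrable_EFinD.
Qed.

Lemma cintegrableZ (c : C) (f : R -> C) : cintegrable f ->
  cintegrable (fun t => c * f t).
Proof.
move=> [fr fi]; split.
- under [X in EFin \o X]eq_fun do rewrite complex_ReM -mulNr.
  by apply: integrable_EFinD; exact: integrable_EFinZl.
- under [X in EFin \o X]eq_fun do rewrite complex_ImM.
  by apply: integrable_EFinD; exact: integrable_EFinZl.
Qed.

Lemma cintegrable0 : cintegrable (fun=> 0).
Proof. by split; exact: integrable0. Qed.

Lemma cintD (f g : R -> C) : cintegrable f -> cintegrable g ->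
  cint (fun t => f t + g t) = cint f + cint g.
Proof.
move=> [fr fi] [gr gi]; apply: complex_eqP; rewrite ?complex_ReD ?complex_ImD /=.
- under eq_Rintegral do rewrite complex_ReD; exact: RintegralD.
- under eq_Rintegral do rewrite complex_ImD; exact: RintegralD.
Qed.

Lemma cintZ (c : C) (f : R -> C) : cintegrable f ->
  cint (fun t => c * f t) = c * cint f.
Proof.
move=> [fr fi]; apply: complex_eqP; rewrite ?complex_ReM ?complex_ImM /=.
- under eq_Rintegral do rewrite complex_ReM -mulNr.
  rewrite RintegralD //; [|exact: integrable_EFinZl..].
  by rewrite !RintegralZl // mulNr.
- under eq_Rintegral do rewrite complex_ImM.
  rewrite RintegralD //; [|exact: integrable_EFinZl..].
  by rewrite !RintegralZl.
Qed.

Lemma cint0 : cint (fun=> 0 : C) = 0.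
Proof. by apply: complex_eqP => /=; rewrite Rintegral_cst ?mul0r. Qed.

Lemma cint_conj (f : R -> C) : cintegrable f ->
  cint (fun t => conjc (f t)) = conjc (cint f).
Proof.
move=> [fr fi]; apply: complex_eqP => /=.
- by apply: eq_Rintegral => t _; case: (f t).
- rewrite -mulN1r -RintegralZl //.
  by apply: eq_Rintegral => t _; rewrite mulN1r; case: (f t).
Qed.

Lemma cintegrable_sum (I : Type) (r : seq I) (Q : pred I) (f : I -> R -> C) :
  (forall i, Q i -> cintegrable (f i)) ->
  cintegrable (fun t => \sum_(i <- r | Q i) f i t).
Proof.
move=> hf; elim: r => [|i r IH].
  under [X in cintegrable X]eq_fun do rewrite big_nil; exact: cintegrable0.
under [X in cintegrable X]eq_fun do rewrite big_cons.
by case: (boolP (Q i)) => // Qi; apply: cintegrableD => //; exact: hf.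
Qed.

Lemma cint_sum (I : Type) (r : seq I) (Q : pred I) (f : I -> R -> C) :
  (forall i, Q i -> cintegrable (f i)) ->
  cint (fun t => \sum_(i <- r | Q i) f i t) = \sum_(i <- r | Q i) cint (f i).
Proof.
move=> hf; elim: r => [|i r IH].
  rewrite big_nil; under [X in cint X]eq_fun do rewrite big_nil; exact: cint0.
rewrite big_cons; under [X in cint X]eq_fun do rewrite big_cons.
case: (boolP (Q i)) => // Qi; rewrite cintD ?IH //; first exact: hf.
exact: cintegrable_sum.
Qed.

Definition mxintegrable p q (F : R -> 'M[C]_(p, q)) : Prop :=
  forall i j, cintegrable (fun t => F t i j).

Lemma mxintegrableD p q (F G : R -> 'M[C]_(p, q)) :
  mxintegrable F -> mxintegrable G -> mxintegrable (fun t => F t + G t).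
Proof.
by move=> hF hG i j; under [X in cintegrable X]eq_fun do rewrite mxE; exact: cintegrableD.
Qed.

Lemma mxintegrableZ p q (c : C) (F : R -> 'M[C]_(p, q)) :
  mxintegrable F -> mxintegrable (fun t => c *: F t).
Proof. by move=> hF i j; under [X in cintegrable X]eq_fun do rewrite mxE; exact: cintegrableZ. Qed.

Lemma mxintegrableN p q (F : R -> 'M[C]_(p, q)) :
  mxintegrable F -> mxintegrable (fun t => - F t).
Proof. by move=> /(mxintegrableZ (-1)); under [X in mxintegrable X]eq_fun do rewrite scaleN1r. Qed.

Lemma mxintegrable_mull p q r (A : 'M[C]_(p, q)) (F : R -> 'M[C]_(q, r)) :
  mxintegrable F -> mxintegrable (fun t => A *m F t).
Proof.
move=> hF i j; under [X in cintegrable X]eq_fun do rewrite mxE.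
by apply: cintegrable_sum => k _; exact: cintegrableZ.
Qed.

Lemma mxintegrable_mulr p q r (A : 'M[C]_(q, r)) (F : R -> 'M[C]_(p, q)) :
  mxintegrable F -> mxintegrable (fun t => F t *m A).
Proof.
move=> hF i j; under [X in cintegrable X]eq_fun do rewrite mxE.
apply: cintegrable_sum => k _; under [X in cintegrable X]eq_fun do rewrite mulrC.
exact: cintegrableZ.
Qed.

Lemma mxintegrable_sum p q (I : Type) (r : seq I) (Q : pred I)
    (F : I -> R -> 'M[C]_(p, q)) :
  (forall i, Q i -> mxintegrable (F i)) ->
  mxintegrable (fun t => \sum_(i <- r | Q i) F i t).
Proof.
move=> hF i j; under [X in cintegrable X]eq_fun do rewrite summxE.
by apply: cintegrable_sum => k /hF.
Qed.

Lemma mxintD p q (F G : R -> 'M[C]_(p, q)) :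
  mxintegrable F -> mxintegrable G ->
  mxint (fun t => F t + G t) = mxint F + mxint G.
Proof.
move=> hF hG; apply/matrixP => i j; rewrite !mxE -cintD //.
by congr cint; apply/funext => t; rewrite mxE.
Qed.

Lemma mxintZ p q (c : C) (F : R -> 'M[C]_(p, q)) :
  mxintegrable F -> mxint (fun t => c *: F t) = c *: mxint F.
Proof.
move=> hF; apply/matrixP => i j; rewrite !mxE -cintZ //.
by congr cint; apply/funext => t; rewrite mxE.
Qed.

Lemma mxintN p q (F : R -> 'M[C]_(p, q)) :
  mxintegrable F -> mxint (fun t => - F t) = - mxint F.
Proof.
move=> hF; rewrite -scaleN1r -mxintZ //.
by congr mxint; apply/funext => t; rewrite scaleN1r.
Qed.

Lemma mxintB p q (F G : R -> 'M[C]_(p, q)) :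
  mxintegrable F -> mxintegrable G ->
  mxint (fun t => F t - G t) = mxint F - mxint G.
Proof. by move=> hF hG; rewrite mxintD ?mxintN//; exact: mxintegrableN. Qed.

Lemma mxint_mull p q r (A : 'M[C]_(p, q)) (F : R -> 'M[C]_(q, r)) :
  mxintegrable F -> mxint (fun t => A *m F t) = A *m mxint F.
Proof.
move=> hF; apply/matrixP => i j; rewrite !mxE.
under eq_bigr do rewrite mxE -cintZ //.
rewrite -cint_sum => [|k _]; last exact: cintegrableZ.
by congr cint; apply/funext => t; rewrite mxE.
Qed.

Lemma mxint_mulr p q r (A : 'M[C]_(q, r)) (F : R -> 'M[C]_(p, q)) :
  mxintegrable F -> mxint (fun t => F t *m A) = mxint F *m A.
Proof.
move=> hF; apply/matrixP => i j; rewrite !mxE.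
under eq_bigr do rewrite mxE mulrC -cintZ //.
rewrite -cint_sum => [|k _]; last exact: cintegrableZ.
congr cint; apply/funext => t; rewrite mxE.
by apply: eq_bigr => k _; rewrite mulrC.
Qed.

Lemma mxint0 p q : mxint (fun=> 0 : 'M[C]_(p, q)) = 0.
Proof.
apply/matrixP => i j; rewrite !mxE -[RHS]cint0.
by congr cint; apply/funext => t; rewrite mxE.
Qed.

Lemma mxint_adj p q (F : R -> 'M[C]_(p, q)) : mxintegrable F ->
  mxint (fun t => (F t) ^t*) = (mxint F) ^t*.
Proof.
move=> hF; apply/matrixP => i j; rewrite !mxE.
rewrite -[RHS](cint_conj (hF j i)).
by congr cint; apply/funext => t; rewrite !mxE.
Qed.

End ComplexIntegral.

(** * Integrals of derivatives over the real line *)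

Section RealLine.
Local Set Implicit Arguments.
Local Unset Strict Implicit.
Context {R : realType}.
Local Notation C := R[i].
Local Notation mu := (@lebesgue_measure R).
Local Open Scope classical_set_scope.

Lemma Rintegral_derive (F f : R -> R) (a b : R) : a < b ->
  (forall t, is_derive t (1 : R) F (f t)) -> continuous f ->
  \int[mu]_(t in `[a, b]) f t = F b - F a.
Proof.
move=> ab dF cf.
have cF : continuous F.
  by move=> t; apply: differentiable_continuous; apply/derivable1_diffP.
rewrite /Rintegral (@continuous_FTC2 _ f F) //.
- exact: continuous_subspaceT.
- split; [by move=> t _|..].
  + by apply: cvg_at_right_filter; exact: cF.
  + by apply: cvg_at_left_filter; exact: cF.
- by move=> t _; rewrite derive1E; apply: derive_val.
Qed.

Lemma Rintegral_derive_le (F f : R -> R) (a b : R) : a < b ->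
  (forall t, is_derive t (1 : R) F (f t)) -> continuous f ->
  mu.-integrable setT (EFin \o f) ->
  `|F b - F a| <= \int[mu]_t `|f t|.
Proof.
move=> ab dF cf fi.
have fab : mu.-integrable `[a, b] (EFin \o f) by apply: integrableS fi.
rewrite -(Rintegral_derive ab dF cf); apply: le_trans (le_normr_Rintegral _ fab) _ => //.
rewrite /Rintegral fine_le//.
- by apply: integrable_fin_num => //; exact: integrable_norm.
- by apply: integrable_fin_num => //; exact: integrable_norm.
apply: ge0_subset_integral => //.
have h := measurable_int _ fi.
by apply/measurable_EFinP; apply: measurableT_comp => //; apply/measurable_EFinP.
Qed.

(** Dominated convergence, with |f| dominating the truncations to [-n, n]. *)
Lemma cvg_Rintegral_sym_itv (f : R -> R) : mu.-integrable setT (EFin \o f) ->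
  \int[mu]_(t in `[- n%:R, n%:R]) f t @[n --> \oo] --> \int[mu]_t f t.
Proof.
move=> fi.
have mf := measurable_int _ fi.
apply: fine_cvg; rewrite fineK; last exact: integrable_fin_num.
under eq_fun do rewrite integral_mkcond.
apply: (@dominated_cvg _ _ _ mu setT _ _ _ (fun t => `|(f t)%:E|%E)) => //.
- move=> n.
  have mI : measurable (`[- n%:R, n%:R] : set R) by [].
  exact: (proj1 (measurable_restrictT (EFin \o f) mI) (measurable_funTS mf)).
- move=> t _; apply: cvg_near_cst.
  near=> n; rewrite /patch mem_set //= in_itv /= -ler_norml.
  by near: n; exact: nbhs_infty_ger.
- exact: integrable_abse fi.
- by move=> n t _; rewrite /patch; case: ifP => // _; rewrite abse0 abse_ge0.
Unshelve. all: by end_near.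
Qed.

(* Integrability of F + t F' = (t F)' makes t F(t) bounded, so that F vanishes
   at both infinities. *)
Lemma Rintegral_derive_line (F f : R -> R) :
  (forall t, is_derive t (1 : R) F (f t)) -> continuous f ->
  mu.-integrable setT (EFin \o f) ->
  mu.-integrable setT (EFin \o (fun t => F t + t * f t)) ->
  \int[mu]_t f t = 0.
Proof.
move=> dF cf fi gi.
pose G t := t * F t; pose g t := F t + t * f t.
have cF : continuous F.
  by move=> t; apply: differentiable_continuous; apply/derivable1_diffP.
have cg : continuous g.
  move=> t; apply: cvgD; first exact: cF.
  by apply: cvgM; [exact: cvg_id|exact: cf].
have dG t : is_derive t (1 : R) G (g t).
  have := @is_deriveM _ _ id F t 1 1 (f t) (is_derive_id _ _) (dF t).
  by move/is_derive_eq; apply; rewrite /g /GRing.scale /= mulr1 addrC.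
have G0 : G 0 = 0 by rewrite /G mul0r.
pose M := \int[mu]_t `|g t|.
have hM t : 0 < t -> `|F t| <= M / t /\ `|F (- t)| <= M / t.
  move=> t0; split; rewrite ler_pdivlMr // mulrC.
  - have := Rintegral_derive_le t0 dG cg gi.
    by rewrite G0 subr0 /G normrM gtr0_norm.
  - have Nt0 : - t < 0 by rewrite oppr_lt0.
    have := Rintegral_derive_le Nt0 dG cg gi.
    by rewrite G0 sub0r normrN /G normrM normrN (gtr0_norm t0).
apply: cvg_unique (cvg_Rintegral_sym_itv fi) _ => //.
apply: (@cvg_trans _ ((fun n => F n%:R - F (- n%:R)) @ \oo)).
  apply: near_eq_cvg; near=> n.
  have n0 : 0 < n%:R :> R by rewrite ltr0n; near: n; exact: nbhs_infty_gt.
  by rewrite (Rintegral_derive _ dF cf) // gtrN.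
apply/cvgr0Pnorm_le => e e0; near=> n.
have n0 : 0 < n%:R :> R by rewrite ltr0n; near: n; exact: nbhs_infty_gt.
have [h1 h2] := hM _ n0.
apply: le_trans (ler_normB _ _) _.
apply: le_trans (lerD h1 h2) _.
rewrite -mulrDl -mulr2n ler_pdivrMr // mulrC -ler_pdivrMr //.
by near: n; exact: nbhs_infty_ger.
Unshelve. all: by end_near.
Qed.

End RealLine.

(** * Complex derivatives *)

Section Derivatives.
Local Set Implicit Arguments.
Local Unset Strict Implicit.
Local Open Scope classical_set_scope.

(** The epsilon form of a derivative, multiplied out so that h = 0 is allowed. Conjugation,
    restriction to real increments, affine substitution and the estimate for Cauchy integrals are
    all checked in this form. *)
Lemma is_derive1P (K : numFieldType) (f : K^o -> K^o) (z d : K^o) :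
  is_derive z (1 : K^o) f d <->
  (forall e, 0 < e -> exists2 r, 0 < r & forall h, `|h| < r ->
     `|f (h + z) - f z - h * d| <= e * `|h|).
Proof.
split.
- move=> [dvf dfv] e e0.
  have : (fun h => h^-1 *: (f (h *: (1 : K^o) + z) - f z)) @ 0^' --> d.
    by rewrite -dfv; exact: dvf.
  move=> /cvgrPdist_le /(_ e e0) [r /= r0 hr]; exists r => // h hh.
  have [->|h0] := eqVneq h 0; first by rewrite add0r subrr mul0r subrr normr0 mulr0.
  have := hr h; rewrite /= sub0r normrN => /(_ hh h0).
  rewrite -(ler_pM2r (_ : 0 < `|h|)) ?normr_gt0 // -normrM mulrBl.
  rewrite -[X in `|_ - X|]mulrC /GRing.scale /= mulrA mulfV // mul1r mulr1.
  by rewrite distrC [d * h]mulrC.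
- move=> H.
  have H1 : (fun h => h^-1 *: (f (h *: (1 : K^o) + z) - f z)) @ 0^' --> d.
    apply/cvgrPdist_le => e /H [r r0 hr]; exists r => //= h /=.
    rewrite sub0r normrN => hh h0.
    rewrite -(ler_pM2r (_ : 0 < `|h|)) ?normr_gt0 // -normrM mulrBl.
    rewrite -[X in `|_ - X|]mulrC /GRing.scale /= mulrA mulfV // mul1r mulr1.
    by rewrite distrC [d * h]mulrC; exact: hr.
  by apply: DeriveDef; [apply: cvgP H1|apply/cvg_lim].
Qed.

Context {R : realType}.
Local Notation C := R[i].

Definition cderive (f : C -> C) (z d : C) : Prop :=
  @is_derive C C^o C^o z 1 f d.

Lemma cderiveP (f : C -> C) z d : cderive f z d <->
  (forall e, 0 < e -> exists2 r, 0 < r & forall h, `|h| < r ->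
     `|f (h + z) - f z - h * d| <= e * `|h|).
Proof. exact: is_derive1P. Qed.

Lemma cderive_cst (c z : C) : cderive (fun=> c) z 0.
Proof. exact: is_derive_cst. Qed.

Lemma cderive_id (z : C) : cderive id z 1.
Proof. exact: is_derive_id. Qed.

Lemma cderiveD (f g : C -> C) z a b : cderive f z a -> cderive g z b ->
  cderive (fun w => f w + g w) z (a + b).
Proof. by move=> hf hg; exact: (is_deriveD hf hg). Qed.

Lemma cderiveM (f g : C -> C) z a b : cderive f z a -> cderive g z b ->
  cderive (fun w => f w * g w) z (a * g z + f z * b).
Proof.
move=> hf hg; apply: (is_derive_eq (is_deriveM hf hg)).
by rewrite /GRing.scale /= addrC [g z * a]mulrC.
Qed.

Lemma cderive_sum (I : Type) (r : seq I) (Q : pred I) (f : I -> C -> C) z d :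
  (forall i, cderive (f i) z (d i)) ->
  cderive (fun w => \sum_(i <- r | Q i) f i w) z (\sum_(i <- r | Q i) d i).
Proof.
move=> hf; elim: r => [|i r IH].
  by rewrite big_nil (_ : (fun w => _) = fun=> 0);
    [exact: cderive_cst|apply/funext => w; rewrite big_nil].
rewrite big_cons (_ : (fun w => _) = fun w => if Q i then f i w + \sum_(j <- r | Q j) f j w
   else \sum_(j <- r | Q j) f j w); last by apply/funext => w; rewrite big_cons.
by case: (Q i) => //; exact: cderiveD.
Qed.

Lemma cderive_eq (f : C -> C) z a b : cderive f z a -> a = b -> cderive f z b.
Proof. by move=> h <-. Qed.

Lemma cderiveV (f : C -> C) z a : f z != 0 -> cderive f z a ->
  cderive (fun w => (f w)^-1) z (- a / f z ^+ 2).
Proof.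
move=> f0 hf.
have [df dv] := hf.
have := derivableV f0 df.
move=> h; apply: DeriveDef => //.
rewrite (deriveV f0 df) dv /GRing.scale /=.
by rewrite mulNr mulrC mulNr.
Qed.

(** Conjugation is not complex differentiable, so no chain rule applies. The error of [f] at the
    increment conj h is the conjugate of the error claimed at [h], and the norms agree. *)
Lemma cderive_conj (f : C -> C) z d : cderive f (conjc z) d ->
  cderive (fun w => conjc (f (conjc w))) z (conjc d).
Proof.
move=> /cderiveP hf; apply/cderiveP => e e0.
have [r r0 hr] := hf e e0; exists r => // h.
rewrite -normcJ => /hr; rewrite normcJ.
congr (_ <= _); rewrite -[LHS]normcJ; congr (`|_|).
by rewrite 2!raddfB /= rmorphM /= conjcK raddfD.
Qed.

End Derivatives.

(** * Restriction to the real axis and derivatives of matrix functions *)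

Section MatrixDerivatives.
Local Set Implicit Arguments.
Local Unset Strict Implicit.
Context {R : realType}.
Local Notation C := R[i].
Local Notation mu := (@lebesgue_measure R).

Lemma normc_ge_Im (x : C) : `|complex.Im x|%:C <= `|x|.
Proof.
case: x => a b /=; have := normc_ge_Re ((a +i* b) * 'i).
rewrite normrM (_ : `|'i%C| = 1 :> C) ?mulr1; last first.
  by rewrite normc_def /= expr0n expr1n add0r sqrtr1.
by rewrite /= !(mulr0, mulr1, sub0r) normrN.
Qed.

(** Among the complex increments only the real ones are kept, and the real part of the error is
    bounded by its norm. *)
Lemma is_derive_Re_restrict (f : C -> C) (t : R) (d : C) : cderive f t%:C d ->
  is_derive t (1 : R) (fun s => complex.Re (f s%:C)) (complex.Re d).
Proof.
move=> /cderiveP hf0; apply/is_derive1P => e e0.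
have [|r r0 hr] := hf0 e%:C; first by rewrite ltcR.
have rE : r = (complex.Re r)%:C by apply/esym/RRe_real/gtr0_real.
exists (complex.Re r) => [|h hh]; first by rewrite -ltcR -rE.
have nh : `|h%:C| = `|h|%:C by rewrite normc_def /= expr0n addr0 sqrtr_sqr.
have /hr : `|h%:C| < r by rewrite rE nh ltcR.
rewrite nh -(rmorphM (real_complex R)) => /(le_trans (normc_ge_Re _)).
rewrite lecR; congr (`|_| <= _); rewrite -(rmorphD (real_complex R)) /=; clear.
by case: (f _) (f _) d => ? ? [? ?] [? ?] /=; rewrite mul0r subr0.
Qed.

Lemma is_derive_Im_restrict (f : C -> C) (t : R) (d : C) : cderive f t%:C d ->
  is_derive t (1 : R) (fun s => complex.Im (f s%:C)) (complex.Im d).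
Proof.
move=> hf.
(* Im x is the real part of -i x, which reduces the claim to real parts. *)
have /is_derive_Re_restrict : cderive (fun w => - 'i * f w) t%:C (- 'i * d).
  by apply: cderive_eq (cderiveM (cderive_cst _ _) hf) _; rewrite mul0r add0r.
rewrite (_ : complex.Re (- 'i * d) = complex.Im d); last first.
  by case: d {hf} => a b; rewrite /= oppr0 mul0r mulN1r sub0r opprK.
congr (is_derive _ _ _ _); apply/funext => s.
by case: (f _) => a b; rewrite /= oppr0 mul0r mulN1r sub0r opprK.
Qed.

Lemma cderive_continuous_Re (f : C -> C) : (forall t : R, exists d, cderive f t%:C d) ->
  continuous (fun s : R => complex.Re (f s%:C)).
Proof.
move=> hf t; have [d /is_derive_Re_restrict [h _]] := hf t.
exact/differentiable_continuous/derivable1_diffP.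
Qed.

Lemma cderive_continuous_Im (f : C -> C) : (forall t : R, exists d, cderive f t%:C d) ->
  continuous (fun s : R => complex.Im (f s%:C)).
Proof.
move=> hf t; have [d /is_derive_Im_restrict [h _]] := hf t.
exact/differentiable_continuous/derivable1_diffP.
Qed.

(** Differentiability of [f'] provides its continuity along the axis, which the fundamental theorem
    of calculus asks for. *)
Lemma cint_derive (f f' : C -> C) :
  (forall t : R, cderive f t%:C (f' t%:C)) ->
  (forall t : R, exists d, cderive f' t%:C d) ->
  cintegrable (fun t => f' t%:C) ->
  cintegrable (fun t => f t%:C + t%:C * f' t%:C) ->
  cint (fun t => f' t%:C) = 0.
Proof.
move=> df df' [ir ii] [jr ji]; apply: complex_eqP => /=.
- apply: (@Rintegral_derive_line _ (fun t => complex.Re (f t%:C))) => //.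
  + by move=> t; exact: is_derive_Re_restrict.
  + exact: cderive_continuous_Re.
  + rewrite [X in EFin \o X](_ : _ = fun t => complex.Re (f t%:C + t%:C * f' t%:C)) //.
    by apply/funext => t; rewrite complex_ReD complex_ReM /= mul0r subr0.
- apply: (@Rintegral_derive_line _ (fun t => complex.Im (f t%:C))) => //.
  + by move=> t; exact: is_derive_Im_restrict.
  + exact: cderive_continuous_Im.
  + rewrite [X in EFin \o X](_ : _ = fun t => complex.Im (f t%:C + t%:C * f' t%:C)) //.
    by apply/funext => t; rewrite complex_ImD complex_ImM /= mul0r addr0.
Qed.

Lemma mxint_derive p q (F F' : C -> 'M[C]_(p, q)) :
  (forall t : R, mx_is_derive F t%:C (F' t%:C)) ->
  (forall t : R, exists D, mx_is_derive F' t%:C D) ->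
  mxintegrable (fun t => F' t%:C) ->
  mxintegrable (fun t => F t%:C + t%:C *: F' t%:C) ->
  mxint (fun t => F' t%:C) = 0.
Proof.
move=> dF dF' h1 h2; apply/matrixP => i j; rewrite !mxE.
apply: (@cint_derive (fun w => F w i j) (fun w => F' w i j)).
- by move=> t; exact: dF.
- by move=> t; have [D hD] := dF' t; exists (D i j); exact: hD.
- exact: h1.
- have := h2 i j; congr cintegrable; apply/funext => t.
  by rewrite !mxE.
Qed.

Lemma mx_is_derive_eq p q (F : C -> 'M[C]_(p, q)) z D D' :
  mx_is_derive F z D -> D = D' -> mx_is_derive F z D'.
Proof. by move=> h <-. Qed.

Lemma eq_mx_is_derive p q (F G : C -> 'M[C]_(p, q)) z D :
  (forall w, F w = G w) -> mx_is_derive F z D -> mx_is_derive G z D.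
Proof. by move=> /funext ->. Qed.

Lemma mx_is_derive_cst p q (A : 'M[C]_(p, q)) z : mx_is_derive (fun=> A) z 0.
Proof. by move=> i j; rewrite mxE; exact: cderive_cst. Qed.

Lemma mx_is_deriveD p q (F G : C -> 'M[C]_(p, q)) z A B :
  mx_is_derive F z A -> mx_is_derive G z B ->
  mx_is_derive (fun w => F w + G w) z (A + B).
Proof.
move=> hF hG i j; rewrite (_ : (fun w => _) = fun w => F w i j + G w i j).
  by rewrite mxE; exact: cderiveD.
by apply/funext => w; rewrite mxE.
Qed.

Lemma mx_is_deriveM p q r (F : C -> 'M[C]_(p, q)) (G : C -> 'M[C]_(q, r)) z A B :
  mx_is_derive F z A -> mx_is_derive G z B ->
  mx_is_derive (fun w => F w *m G w) z (A *m G z + F z *m B).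
Proof.
move=> hF hG i j; rewrite (_ : (fun w => _) = fun w => \sum_k F w i k * G w k j).
  rewrite !mxE -big_split /=; apply: cderive_sum => k; exact: cderiveM.
by apply/funext => w; rewrite mxE.
Qed.

Lemma mx_is_deriveZ p q (f : C -> C) (F : C -> 'M[C]_(p, q)) z a A :
  cderive f z a -> mx_is_derive F z A ->
  mx_is_derive (fun w => f w *: F w) z (a *: F z + f z *: A).
Proof.
move=> hf hF i j; rewrite (_ : (fun w => _) = fun w => f w * F w i j).
  by rewrite !mxE; exact: cderiveM.
by apply/funext => w; rewrite mxE.
Qed.

Lemma mx_is_derive_mull p q r (A : 'M[C]_(p, q)) (G : C -> 'M[C]_(q, r)) z B :
  mx_is_derive G z B -> mx_is_derive (fun w => A *m G w) z (A *m B).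
Proof.
move=> hG; apply: mx_is_derive_eq (mx_is_deriveM (mx_is_derive_cst A z) hG) _.
by rewrite mul0mx add0r.
Qed.

Lemma mx_is_deriveZl p q (c : C) (G : C -> 'M[C]_(p, q)) z B :
  mx_is_derive G z B -> mx_is_derive (fun w => c *: G w) z (c *: B).
Proof.
move=> hG; apply: mx_is_derive_eq (mx_is_deriveZ (cderive_cst c z) hG) _.
by rewrite scale0r add0r.
Qed.

Lemma mx_is_deriveN p q (G : C -> 'M[C]_(p, q)) z B :
  mx_is_derive G z B -> mx_is_derive (fun w => - G w) z (- B).
Proof.
move=> /(mx_is_deriveZl (-1)); rewrite scaleN1r.
by apply: eq_mx_is_derive => w; rewrite scaleN1r.
Qed.

Lemma mx_is_derive_block p q r s (F1 : C -> 'M[C]_(p, r)) (F2 : C -> 'M[C]_(p, s))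
    (F3 : C -> 'M[C]_(q, r)) (F4 : C -> 'M[C]_(q, s)) z A1 A2 A3 A4 :
  mx_is_derive F1 z A1 -> mx_is_derive F2 z A2 ->
  mx_is_derive F3 z A3 -> mx_is_derive F4 z A4 ->
  mx_is_derive (fun w => block_mx (F1 w) (F2 w) (F3 w) (F4 w)) z (block_mx A1 A2 A3 A4).
Proof.
move=> h1 h2 h3 h4 i j.
case: (split_ordP i) => i' ->; case: (split_ordP j) => j' ->.
- rewrite block_mxEul (_ : (fun w => _) = fun w => F1 w i' j') //.
  by apply/funext => w; rewrite block_mxEul.
- rewrite block_mxEur (_ : (fun w => _) = fun w => F2 w i' j') //.
  by apply/funext => w; rewrite block_mxEur.
- rewrite block_mxEdl (_ : (fun w => _) = fun w => F3 w i' j') //.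
  by apply/funext => w; rewrite block_mxEdl.
- rewrite block_mxEdr (_ : (fun w => _) = fun w => F4 w i' j') //.
  by apply/funext => w; rewrite block_mxEdr.
Qed.

Lemma mx_is_derive_fstar p q (F : C -> 'M[C]_(p, q)) z D :
  mx_is_derive F (conjc z) D -> mx_is_derive (fstar F) z (D ^t*).
Proof.
move=> hF i j; rewrite (_ : (fun w => _) = fun w => conjc (F (conjc w) j i)).
  rewrite !mxE; apply: (@cderive_conj _ (fun w => F w j i)); exact: hF.
by apply/funext => w; rewrite !mxE.
Qed.

End MatrixDerivatives.

(** * Matrix polynomials and the weight *)

Section PolyEval.
Local Set Implicit Arguments.
Local Unset Strict Implicit.
Context {R : realType} {N : nat}.
Local Notation C := R[i].
Local Notation M := 'M[C]_N.+1.
Implicit Types (U V : {poly M}) (z : C).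

Lemma adjmx_mul p q r (A : 'M[C]_(p, q)) (B : 'M[C]_(q, r)) :
  (A *m B) ^t* = B ^t* *m A ^t*.
Proof. by rewrite trmx_mul map_mxM. Qed.

Lemma adjmxK p q (A : 'M[C]_(p, q)) : (A ^t*) ^t* = A.
Proof. by apply/matrixP => i j; rewrite !mxE conjCK. Qed.

Lemma adjmxD p q (A B : 'M[C]_(p, q)) : (A + B) ^t* = A ^t* + B ^t*.
Proof. by rewrite linearD map_mxD. Qed.

Lemma adjmxN p q (A : 'M[C]_(p, q)) : (- A) ^t* = - A ^t*.
Proof. by rewrite linearN map_mxN. Qed.

Lemma adjmxZ p q (c : C) (A : 'M[C]_(p, q)) : (c *: A) ^t* = conjc c *: A ^t*.
Proof. by rewrite linearZ /= map_mxZ. Qed.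

Lemma adjmx0 p q : (0 : 'M[C]_(p, q)) ^t* = 0.
Proof. by rewrite linear0 map_mx0. Qed.

Lemma adjmx_sum p q (I : Type) (r : seq I) (Q : pred I) (F : I -> 'M[C]_(p, q)) :
  (\sum_(i <- r | Q i) F i) ^t* = \sum_(i <- r | Q i) (F i) ^t*.
Proof.
elim/big_ind2: _ => // [|x1 x2 y1 y2 <- <-]; first exact: adjmx0.
by rewrite adjmxD.
Qed.

Lemma comm_poly_scalar U z : comm_poly U z%:M.
Proof. by apply: comm_coef_poly => i; exact: scalar_mxC. Qed.

Lemma pevalD U V z : peval (U + V) z = peval U z + peval V z.
Proof. exact: hornerD. Qed.

Lemma pevalN U z : peval (- U) z = - peval U z.
Proof. exact: hornerN. Qed.

Lemma pevalB U V z : peval (U - V) z = peval U z - peval V z.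
Proof. by rewrite pevalD pevalN. Qed.

Lemma pevalM U V z : peval (U * V) z = peval U z *m peval V z.
Proof. exact: hornerM_comm (comm_poly_scalar V z). Qed.

Lemma pevalC (A : M) z : peval A%:P z = A.
Proof. exact: hornerC. Qed.

Lemma pevalX z : peval 'X z = z%:M :> M.
Proof. exact: hornerX. Qed.

Lemma peval_mulCl (A : M) U z : peval (A%:P * U) z = A *m peval U z.
Proof. by rewrite pevalM pevalC. Qed.

Lemma peval_mulCr (A : M) U z : peval (U * A%:P) z = peval U z *m A.
Proof. by rewrite pevalM pevalC. Qed.

Lemma peval_mulX U z : peval ('X * U) z = z *: peval U z.
Proof. by rewrite pevalM pevalX mul_scalar_mx. Qed.

Lemma peval_sum (I : Type) (r : seq I) (Q : pred I) (F : I -> {poly M}) z :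
  peval (\sum_(i <- r | Q i) F i) z = \sum_(i <- r | Q i) peval (F i) z.
Proof. exact: horner_sum. Qed.

Lemma scalar_mxX z k : (z%:M : M) ^+ k = (z ^+ k)%:M.
Proof. by elim: k => [|k IH]; rewrite ?expr0 // exprS IH exprS scalar_mxM. Qed.

Lemma peval_coef_wide n U z : (size U <= n)%N ->
  peval U z = \sum_(i < n) z ^+ i *: U`_i.
Proof.
move=> hn; rewrite /peval (horner_coef_wide _ hn); apply: eq_bigr => i _.
by rewrite scalar_mxX; exact: mul_mx_scalar.
Qed.

Lemma mx_is_derive_peval U z : mx_is_derive (peval U) z (peval U^`() z).
Proof.
elim/poly_ind: U => [|U A IH].
  apply: (eq_mx_is_derive (F := fun=> 0)) => [w|]; first by rewrite /peval horner0.
  by rewrite derivC /peval horner0; exact: mx_is_derive_cst.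
rewrite derivD derivC addr0 derivM derivX mulr1 pevalD pevalM pevalX.
apply: (eq_mx_is_derive (F := fun w => w *: peval U w + A)) => [w|].
  by rewrite pevalD pevalC pevalM pevalX mul_mx_scalar.
apply: mx_is_derive_eq.
  apply: mx_is_deriveD (mx_is_deriveZ (cderive_id z) IH) (mx_is_derive_cst A z).
by rewrite addr0 scale1r addrC mul_mx_scalar.
Qed.

(** The polynomial whose value at z is the adjoint of the value of [U] at conj z. It replaces the
    adjoint of a polynomial under the integral by a polynomial. *)
Definition pstar U : {poly M} := \poly_(i < size U) (U`_i) ^t*.

Lemma size_pstar U : (size (pstar U) <= size U)%N.
Proof. exact: size_poly. Qed.

Lemma peval_pstar U z : peval (pstar U) z = fstar (peval U) z.
Proof.
rewrite (peval_coef_wide z (size_pstar U)) /fstar (peval_coef_wide _ (leqnn _)).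
rewrite adjmx_sum; apply: eq_bigr => i _.
rewrite adjmxZ coef_poly ltn_ord rmorphXn /=; congr (_ ^+ _ *: _).
exact/esym/conjcK.
Qed.

Lemma peval_pstar_real U (t : R) : peval (pstar U) t%:C = (peval U t%:C) ^t*.
Proof. by rewrite peval_pstar /fstar (_ : Num.conj t%:C = t%:C) //; exact: conjc_real. Qed.

End PolyEval.

(** * Integrability against the weight *)

Section WeightIntegrable.
Local Set Implicit Arguments.
Local Unset Strict Implicit.
Context {R : realType} {N : nat}.
Local Notation C := R[i].
Local Notation M := 'M[C]_N.+1.
Local Notation mu := (@lebesgue_measure R).

(* Functions of a complex variable, differentiable along the real axis and
   bounded on it: they may multiply any integrand P W Q with P, Q polynomials. *)
Definition bholo (g : C -> C) : Prop :=
  (forall t : R, exists d, cderive g t%:C d) /\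
  (exists B : R, forall t : R, `|g t%:C| <= B%:C).

Lemma bholo_cst c : bholo (fun=> c).
Proof.
split; first by move=> t; exists 0; exact: cderive_cst.
by exists (complex.Re `|c|) => t; rewrite RRe_real ?normr_real.
Qed.

Lemma bholoM f g : bholo f -> bholo g -> bholo (fun w => f w * g w).
Proof.
move=> [df [B hB]] [dg [D hD]]; split.
  move=> t; have [a ha] := df t; have [b hb] := dg t; eexists.
  exact: cderiveM ha hb.
by exists (B * D) => t; rewrite normrM (rmorphM (real_complex R)) ler_pM.
Qed.

Lemma Im_real_subr (t : R) (z : C) : complex.Im (t%:C - z) = - complex.Im z.
Proof. by case: z => a b /=; rewrite sub0r. Qed.

Lemma real_sub_neq0 (t : R) (z : C) : complex.Im z != 0 -> t%:C - z != 0.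
Proof. by apply: contra_neq => e; rewrite -(opprK (complex.Im z)) -(Im_real_subr t) e oppr0. Qed.

Lemma norm_real_sub_ge (t : R) (z : C) : `|complex.Im z|%:C <= `|t%:C - z|.
Proof. by rewrite -(normrN (complex.Im z)) -(Im_real_subr t); exact: normc_ge_Im. Qed.

Lemma cderive_resolvent (z w : C) : w - z != 0 ->
  cderive (fun w => (w - z)^-1) w (- ((w - z)^-1 ^+ 2)).
Proof.
move=> h; apply: cderive_eq (cderiveV (f := fun w => w - z) h _) _.
  apply: cderiveD; [exact: cderive_id|exact: (cderive_cst (- z))].
by rewrite addr0 mulN1r exprVn.
Qed.

Lemma bholo_resolvent (z : C) : complex.Im z != 0 -> bholo (fun w => (w - z)^-1).
Proof.
move=> z0; split.
  by move=> t; eexists; apply: cderive_resolvent; exact: real_sub_neq0.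
exists `|complex.Im z|^-1 => t.
rewrite normfV rmorphV /=; last by rewrite unitfE normr_eq0.
rewrite lef_pV2 ?norm_real_sub_ge // posrE ?normr_gt0 ?real_sub_neq0 //.
by rewrite ltcR normr_gt0.
Qed.

Variables (W : R -> 'M[R]_N.+1) (hW : is_weight W).

(** Each entry is dominated by a constant times a moment integrand of [W]; measurability of the
    factor [g] comes from its continuity along the axis. *)
Lemma mxintegrable_moment (g : C -> C) k : bholo g ->
  mxintegrable (fun t : R => (g t%:C * t%:C ^+ k) *: to_cmx (W t)).
Proof.
move=> [dg [B hB]] i j.
have mom := weight_moments hW i j k.
have H (h : R -> R) : continuous h -> (forall t, `|h t| <= B) ->
   mu.-integrable setT (EFin \o (fun t => h t * (t ^+ k * W t i j))).
  move=> ch bh.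
  apply: (le_integrable _ _ _ (integrable_EFinZl B mom)) => //=.
    apply/measurable_EFinP; apply: measurable_funM.
      exact: continuous_measurable_fun.
    by apply/measurable_EFinP; exact: measurable_int mom.
  move=> t _; rewrite lee_fin !normrM ler_wpM2r ?mulr_ge0 //.
  by rewrite (le_trans (bh t)) // ler_norm.
have E t : ((g t%:C * t%:C ^+ k) *: to_cmx (W t)) i j = g t%:C * (t ^+ k * W t i j)%:C.
  by rewrite !mxE !rmorphM rmorphXn mulrA.
split.
- rewrite [X in EFin \o X](_ : _ = fun t => complex.Re (g t%:C) * (t ^+ k * W t i j)).
    apply: H; first exact: cderive_continuous_Re.
    by move=> t; rewrite -lecR (le_trans (normc_ge_Re _)).
  by apply/funext => t; rewrite E complex_ReM /= mulr0 subr0.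
- rewrite [X in EFin \o X](_ : _ = fun t => complex.Im (g t%:C) * (t ^+ k * W t i j)).
    apply: H; first exact: cderive_continuous_Im.
    by move=> t; rewrite -lecR (le_trans (normc_ge_Im _)).
  by apply/funext => t; rewrite E complex_ImM /= mulr0 add0r.
Qed.

Lemma mxintegrable_weight (g : C -> C) (U V : {poly M}) : bholo g ->
  mxintegrable (fun t : R =>
    g t%:C *: (peval U t%:C *m to_cmx (W t) *m peval V t%:C)).
Proof.
move=> hg.
rewrite (_ : (fun t => _) = fun t : R => \sum_(i < size U) \sum_(j < size V)
   U`_i *m ((g t%:C * t%:C ^+ (i + j)) *: to_cmx (W t)) *m V`_j).
  apply: mxintegrable_sum => i _; apply: mxintegrable_sum => j _.
  by apply: mxintegrable_mulr; apply: mxintegrable_mull; exact: mxintegrable_moment.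
apply/funext => t; rewrite (peval_coef_wide _ (leqnn (size U))).
rewrite (peval_coef_wide _ (leqnn (size V))) !mulmx_suml scaler_sumr.
apply: eq_bigr => i _; rewrite mulmx_sumr scaler_sumr; apply: eq_bigr => j _.
rewrite -!scalemxAl -!scalemxAr -!scalemxAl !scalerA; congr (_ *: _).
by rewrite exprD mulrA mulrAC.
Qed.

End WeightIntegrable.

(** * The matrix-valued pairing defined by the weight *)

Section InnerProduct.
Local Set Implicit Arguments.
Local Unset Strict Implicit.
Context {R : realType} {N : nat}.
Local Notation C := R[i].
Local Notation M := 'M[C]_N.+1.
Local Notation mu := (@lebesgue_measure R).
Variables (W : R -> 'M[R]_N.+1) (hW : is_weight W).
Implicit Types (U V : {poly M}).

(** No adjoint is taken on [V]: the usual pairing of [U] and [V] is [ip U (pstar V)]. In this form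
    matrices factor out on the left of [U] and on the right of [V], and ['X] moves across. *)
Definition ip U V : M :=
  mxint (fun t : R => peval U t%:C *m to_cmx (W t) *m peval V t%:C).

Lemma mxintegrable_ip U V :
  mxintegrable (fun t : R => peval U t%:C *m to_cmx (W t) *m peval V t%:C).
Proof.
have := mxintegrable_weight hW U V (bholo_cst 1).
by congr mxintegrable; apply/funext => t; rewrite scale1r.
Qed.

Lemma ipDl U1 U2 V : ip (U1 + U2) V = ip U1 V + ip U2 V.
Proof.
rewrite /ip -mxintD; [|exact: mxintegrable_ip..].
by congr mxint; apply/funext => t; rewrite pevalD !mulmxDl.
Qed.

Lemma ipDr U V1 V2 : ip U (V1 + V2) = ip U V1 + ip U V2.
Proof.
rewrite /ip -mxintD; [|exact: mxintegrable_ip..].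
by congr mxint; apply/funext => t; rewrite pevalD !mulmxDr.
Qed.

Lemma ipNl U V : ip (- U) V = - ip U V.
Proof.
rewrite /ip -mxintN; last exact: mxintegrable_ip.
by congr mxint; apply/funext => t; rewrite pevalN !mulNmx.
Qed.

Lemma ipBl U1 U2 V : ip (U1 - U2) V = ip U1 V - ip U2 V.
Proof. by rewrite ipDl ipNl. Qed.

Lemma ip0l V : ip 0 V = 0.
Proof. by rewrite -[in LHS](subrr 0) ipBl subrr. Qed.

Lemma ip0r U : ip U 0 = 0.
Proof. by have /eqP := ipDr U 0 0; rewrite addr0 addrC -subr_eq subrr => /eqP <-. Qed.

Lemma ipNr U V : ip U (- V) = - ip U V.
Proof. by apply/eqP; rewrite -addr_eq0 -ipDr addNr ip0r. Qed.

Lemma ip_Cl (A : M) U V : ip (A%:P * U) V = A *m ip U V.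
Proof.
rewrite /ip -mxint_mull; last exact: mxintegrable_ip.
by congr mxint; apply/funext => t; rewrite pevalM pevalC !mulmxA.
Qed.

Lemma ip_Cr U V (A : M) : ip U (V * A%:P) = ip U V *m A.
Proof.
rewrite /ip -mxint_mulr; last exact: mxintegrable_ip.
by congr mxint; apply/funext => t; rewrite pevalM pevalC !mulmxA.
Qed.

Lemma ipX U V : ip ('X * U) V = ip U ('X * V).
Proof.
congr mxint; apply/funext => t; rewrite !pevalM pevalX !mul_scalar_mx.
by rewrite -!scalemxAl -scalemxAr.
Qed.

Lemma ip_suml (I : Type) (r : seq I) (Q : pred I) (F : I -> {poly M}) V :
  ip (\sum_(i <- r | Q i) F i) V = \sum_(i <- r | Q i) ip (F i) V.
Proof.
by elim/big_ind2: _ => // [|x1 x2 y1 y2 <- <-]; [exact: ip0l|exact: ipDl].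
Qed.

Lemma ip_sumr (I : Type) (r : seq I) (Q : pred I) (F : I -> {poly M}) U :
  ip U (\sum_(i <- r | Q i) F i) = \sum_(i <- r | Q i) ip U (F i).
Proof.
by elim/big_ind2: _ => // [|x1 x2 y1 y2 <- <-]; [exact: ip0r|exact: ipDr].
Qed.

Lemma adjmx_weight t : (to_cmx (W t)) ^t* = to_cmx (W t).
Proof.
have [sW _] := weight_posdef hW t.
apply/matrixP => i j; rewrite !mxE -[in LHS]sW mxE; exact: conjc_real.
Qed.

Lemma ip_adj U V : (ip U V) ^t* = ip (pstar V) (pstar U).
Proof.
rewrite /ip -mxint_adj; last exact: mxintegrable_ip.
congr mxint; apply/funext => t.
by rewrite !adjmx_mul adjmx_weight !peval_pstar_real mulmxA.
Qed.

Lemma complex_Re_sum (I : Type) (r : seq I) (Q : pred I) (F : I -> C) :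
  complex.Re (\sum_(i <- r | Q i) F i) = \sum_(i <- r | Q i) complex.Re (F i).
Proof.
by elim/big_ind2: _ => // [x1 x2 y1 y2 <- <-]; exact: complex_ReD.
Qed.

(** For u = a + i b the real part of u W u^* is the sum of the real forms at a and at b, the cross
    terms being imaginary. The equality case is what yields nonsingular norms. *)
Lemma weight_form_ge0 t (u : 'rV[C]_N.+1) :
  0 <= complex.Re ((u *m to_cmx (W t) *m u ^t*) ord0 ord0) ?= iff (u == 0).
Proof.
pose a : 'rV[R]_N.+1 := \row_j complex.Re (u ord0 j).
pose b : 'rV[R]_N.+1 := \row_j complex.Im (u ord0 j).
have E : complex.Re ((u *m to_cmx (W t) *m u ^t*) ord0 ord0) =
    (a *m W t *m a^T) ord0 ord0 + (b *m W t *m b^T) ord0 ord0.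
  rewrite !mxE -big_split /= complex_Re_sum.
  apply: eq_bigr => k _; rewrite !mxE !mulr_suml -big_split.
  rewrite complex_Re_sum.
  apply: eq_bigr => l _; rewrite !mxE.
  by case: (u _ l) (u _ k) => ? ? [? ?] /=; ring.
have [_ pW] := weight_posdef hW t.
have F (v : 'rV[R]_N.+1) : 0 <= (v *m W t *m v^T) ord0 ord0 ?= iff (v == 0).
  have [->|v0] := eqVneq v 0; first by rewrite !mul0mx mxE; exact/leif_refl.
  by rewrite /Order.leif (ltW (pW v v0)) lt_eqF ?pW.
rewrite E -[X in X <= _ ?= iff _](addr0 0).
have -> : (u == 0) = (a == 0) && (b == 0).
  apply/eqP/andP => [u0|[/eqP a0 /eqP b0]].
    by split; apply/eqP/rowP => j; rewrite !mxE u0 mxE.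
  apply/rowP => j; rewrite [RHS]mxE; apply: complex_eqP.
    by have := congr1 (fun v : 'rV_ _ => v ord0 j) a0; rewrite !mxE.
  by have := congr1 (fun v : 'rV_ _ => v ord0 j) b0; rewrite !mxE.
exact: leifD.
Qed.

End InnerProduct.

(** * Nonsingularity of the norms of monic polynomials *)

Section Norms.
Local Set Implicit Arguments.
Local Unset Strict Implicit.
Context {R : realType} {N : nat}.
Local Notation C := R[i].
Local Notation M := 'M[C]_N.+1.
Local Notation mu := (@lebesgue_measure R).
Local Open Scope classical_set_scope.

Lemma finite_real_roots (p : {poly C}) : p != 0 ->
  finite_set [set t : R | p.[t%:C] = 0].
Proof.
move=> p0; have [r pE] := closed_field_poly_normal p.
apply: (@sub_finite_set _ _ [set` [seq complex.Re z | z <- r]]); last exact: finite_seq.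
move=> t /= /eqP; rewrite pE hornerZ mulf_eq0 lead_coef_eq0 (negbTE p0) /=.
by rewrite -/(root _ _) root_prod_XsubC => /(map_f (fun z : C => complex.Re z)).
Qed.

(** Such an [f] vanishes almost everywhere, and a finite zero set together with a null set cannot
    cover [0, 1]. *)
Lemma ge0_integral_eq0_infinite (f : R -> R) : (forall t, 0 <= f t) ->
  mu.-integrable setT (EFin \o f) -> \int[mu]_t f t = 0 ->
  ~ finite_set [set t | f t = 0].
Proof.
move=> f0 fi If fin.
have : (\int[mu]_t `|(f t)%:E| = 0)%E.
  rewrite -(fineK (x := \int[mu]_t _)%E); last exact/integrable_fin_num/integrable_abse.
  rewrite -[RHS]/(0%:E) -[in RHS]If; congr (fine _)%:E.
  by apply: eq_integral => t _; rewrite gee0_abs // lee_fin.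
move/(ae_eq_integral_abs mu measurableT (measurable_int _ fi)) => [A [mA A0 hA]].
pose Z := [set t | f t = 0].
have cZ : countable Z by exact: finite_set_countable.
have mZ : measurable (Z : set (measurableTypeR R)) by apply: countable_measurable.
have : (mu `[0%R, 1%R] <= mu (A `|` Z))%E.
  apply: le_measure; rewrite ?inE //; first exact: measurableU.
  move=> t _ /=; have [ft|ft] := eqVneq (f t) 0; [by right|left].
  by apply: hA => /= H; move/eqP: ft; apply; have := H I; case.
rewrite measureU0 //; last exact: countable_lebesgue_measure0.
by rewrite A0 lebesgue_measure_itv /= lte_fin ltr01 sube0 lee_fin ler10.
Qed.

Variables (W : R -> 'M[R]_N.+1) (hW : is_weight W).

(** If v annihilates the matrix from the left, the nonnegative form of [W] at v U(t) has integral 0,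
    so v U(t) = 0 for infinitely many t. But an entry of v U with v_j nonzero is a nonzero
    polynomial: its top coefficient is v_j because [U] is monic. *)
Lemma ip_pstar_unit (U : {poly M}) : U \is monic -> ip W U (pstar U) \in unitmx.
Proof.
move=> mU; rewrite unitmxE unitfE; apply/negP => /det0P [v v0 vh].
pose u t : 'rV[C]_N.+1 := v *m peval U t%:C.
pose F (t : R) : 'M[C]_1 := u t *m to_cmx (W t) *m (u t) ^t*.
pose f t := complex.Re (F t ord0 ord0).
have FE t : F t = v *m (peval U t%:C *m to_cmx (W t) *m peval (pstar U) t%:C) *m v ^t*.
  by rewrite /F /u adjmx_mul peval_pstar_real !mulmxA.
have iF : mxintegrable F.
  rewrite (funext FE); apply: mxintegrable_mulr; apply: mxintegrable_mull.
  exact: mxintegrable_ip.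
have F0 : mxint F = 0.
  rewrite (funext FE) mxint_mulr ?mxint_mull.
  - by rewrite -/(ip W U (pstar U)) vh mul0mx.
  - exact: mxintegrable_ip.
  - by apply: mxintegrable_mull; exact: mxintegrable_ip.
have f0 t : 0 <= f t by rewrite weight_form_ge0.
have If : \int[mu]_t f t = 0.
  by have := congr1 (fun A : 'M[C]_1 => complex.Re (A ord0 ord0)) F0; rewrite !mxE.
have [rF _] := iF ord0 ord0.
apply: (ge0_integral_eq0_infinite f0 rF If).
have [j vj] : exists j, v ord0 j != 0.
  apply/existsP; rewrite -negb_forall; apply: contra v0 => /forallP h.
  by apply/eqP/rowP => j; rewrite [RHS]mxE; apply/eqP.
pose p : {poly C} := \poly_(i < size U) (v *m U`_i) ord0 j.
have p0 : p != 0.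
  apply: contra vj => /eqP pe.
  have := congr1 (fun q : {poly C} => q`_(size U).-1) pe.
  rewrite coef0 coef_poly ifT; last first.
    by rewrite prednK ?lt0n ?size_poly_eq0 ?monic_neq0.
  by rewrite -/(lead_coef U) (monicP mU) mulmx1 => ->.
apply: sub_finite_set (finite_real_roots p0) => t /= ft.
have /eqP : 0 == f t by rewrite ft.
move=> /eqP; rewrite /f (weight_form_ge0 hW t (u t)) => /eqP ut.
have := congr1 (fun a : 'rV[C]_N.+1 => a ord0 j) ut; rewrite [RHS]mxE => <-.
rewrite /u (peval_coef_wide _ (leqnn _)) horner_poly mulmx_sumr summxE.
by apply: eq_bigr => i _; rewrite -scalemxAr [RHS]mxE mulrC.
Qed.

End Norms.

(** * Orthogonal polynomials *)

Section Orthogonality.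
Local Set Implicit Arguments.
Local Unset Strict Implicit.
Context {R : realType} {N : nat}.
Local Notation C := R[i].
Local Notation M := 'M[C]_N.+1.
Variables (W : R -> 'M[R]_N.+1) (P : nat -> {poly M}).
Hypotheses (hW : is_weight W) (hP : monic_OP W P).
Local Notation ip := (ip W).
Local Notation Q := (fun n => pstar (P n)).
Local Notation gam := (gam W P).

Lemma sum_ord_single (V : nmodType) n (F : 'I_n -> V) k (kn : (k < n)%N) :
  (forall i : 'I_n, (i : nat) != k -> F i = 0) -> \sum_(i < n) F i = F (Ordinal kn).
Proof.
by move=> h; rewrite (bigD1 (Ordinal kn)) //= big1 ?addr0.
Qed.

Lemma size_mulCr (U : {poly M}) (A : M) : (size (U * A%:P)%R <= size U)%N.
Proof. by apply/leq_sizeP => i hi; rewrite coefMC nth_default ?mul0r. Qed.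

Lemma size_mulCl (A : M) (U : {poly M}) : (size (A%:P * U)%R <= size U)%N.
Proof. by apply/leq_sizeP => i hi; rewrite coefCM nth_default ?mulr0. Qed.

Lemma OP_monic n : P n \is monic.
Proof. by case: (hP n). Qed.

Lemma size_OP n : size (P n) = n.+1.
Proof. by case: (hP n). Qed.

Lemma coef_OP n : (P n)`_n = 1.
Proof. by have /monicP := OP_monic n; rewrite /lead_coef size_OP. Qed.

Lemma OP0 : P 0%N = 1.
Proof.
have := size1_polyC (eq_leq (size_OP 0)) => ->.
by rewrite coef_OP.
Qed.

Lemma coef_pstar (U : {poly M}) i : (pstar U)`_i = (U`_i) ^t*.
Proof.
by rewrite coef_poly; case: ltnP => // h; rewrite nth_default // adjmx0.
Qed.

Lemma pstarK (U : {poly M}) : pstar (pstar U) = U.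
Proof. by apply/polyP => i; rewrite !coef_pstar adjmxK. Qed.

Lemma size_pstar_OP n : (size (Q n) <= n.+1)%N.
Proof. by rewrite -(size_OP n); exact: size_pstar. Qed.

Lemma ip_OPl n (V : {poly M}) : (size V <= n)%N -> ip (P n) V = 0.
Proof.
move=> sV; have [_ _ /(_ (pstar V))] := hP n.
move=> /(_ (leq_trans (size_pstar V) sV)) <-; congr mxint; apply/funext => t.
by rewrite -peval_pstar_real pstarK.
Qed.

Lemma ip_OPr n (U : {poly M}) : (size U <= n)%N -> ip U (Q n) = 0.
Proof.
move=> sU; rewrite -[LHS]adjmxK (ip_adj hW) pstarK ip_OPl ?adjmx0 //.
exact: leq_trans (size_pstar U) sU.
Qed.

Lemma gamE n : gam n = invmx (ip (P n) (Q n)).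
Proof.
by congr invmx; congr mxint; apply/funext => t; rewrite peval_pstar_real.
Qed.

Lemma ip_OP_unit n : ip (P n) (Q n) \in unitmx.
Proof. exact/ip_pstar_unit/OP_monic. Qed.

Lemma gam_adj n : (gam n) ^t* = gam n.
Proof.
have h : (ip (P n) (Q n)) ^t* = ip (P n) (Q n) by rewrite (ip_adj hW) pstarK.
by rewrite gamE trmx_inv map_invmx h.
Qed.

Lemma ip_OP_neq j k : j != k -> ip (P j) (Q k) = 0.
Proof.
by rewrite neq_ltn => /orP [h|h]; [apply: ip_OPr; rewrite size_OP|
  apply: ip_OPl; rewrite (leq_trans (size_pstar_OP k))].
Qed.

Lemma size_sub_lead n (U : {poly M}) : (size U <= n.+1)%N ->
  (size (U - (U`_n)%:P * P n)%R <= n)%N.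
Proof.
move=> sU; apply/leq_sizeP => i; rewrite leq_eqVlt => /predU1P [<-|hi].
  by rewrite coefB coefCM coef_OP mulr1 subrr.
rewrite coefB coefCM (nth_default _ (leq_trans sU hi)).
by rewrite [(P n)`_i]nth_default ?size_OP // mulr0 subr0.
Qed.

(** Pairing with [Q n] sees only the top coefficient of [U], multiplied by the invertible norm of
    [P n]; it therefore vanishes and the degree drops. *)
Lemma OP_expansion_eq0 n (U : {poly M}) : (size U <= n)%N ->
  (forall k, (k < n)%N -> ip U (Q k) = 0) -> U = 0.
Proof.
elim: n => [|n IH] sU h; first by apply/eqP; rewrite -size_poly_leq0.
have Un : U`_n = 0.
  have := ip_OPr (size_sub_lead sU); rewrite (ipBl hW) (ip_Cl hW) h // sub0r.
  move/eqP; rewrite oppr_eq0 => /eqP /(congr1 (mulmx^~ (gam n))).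
  by rewrite /= mul0mx gamE mulmxK // ip_OP_unit.
apply: IH => [|k kn]; last by apply: h; rewrite ltnS ltnW.
have := size_sub_lead sU; by rewrite Un mul0r subr0.
Qed.

(** The difference of the two sides is orthogonal to every [Q k] with k < n. *)
Lemma OP_expansion n (U : {poly M}) : (size U <= n)%N ->
  U = \sum_(k < n) (ip U (Q k) *m gam k)%:P * P k.
Proof.
move=> sU; apply/eqP; rewrite -subr_eq0; apply/eqP/(OP_expansion_eq0 (n := n)).
  rewrite (leq_trans (size_polyD _ _)) // size_polyN geq_max sU /=.
  apply: (leq_trans (size_sum _ _ _)); apply/bigmax_leqP => k _.
  by rewrite (leq_trans (size_mulCl _ _)) // size_OP.
move=> k kn.
rewrite (ipBl hW).
rewrite (ip_suml hW) (sum_ord_single kn).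
  by rewrite (ip_Cl hW) gamE mulmxKV ?ip_OP_unit // subrr.
by move=> i ik; rewrite (ip_Cl hW) ip_OP_neq ?mulmx0.
Qed.

(* phi k = P_k(z) gives the Christoffel-Darboux kernel as a polynomial in its
   conjugated variable; phi k = int P_k(t) W(t) / (t - z) gives its Cauchy
   integral. *)
Definition CDkernel n (phi : nat -> M) : {poly M} :=
  \sum_(k < n) Q k * (gam k *m phi k)%:P.

Lemma size_CDkernel n phi : (size (CDkernel n phi) <= n)%N.
Proof.
apply: (leq_trans (size_sum _ _ _)); apply/bigmax_leqP => k _.
exact: leq_trans (size_mulCr _ _) (leq_trans (size_pstar_OP k) (ltn_ord k)).
Qed.

Lemma ip_CDkernel n phi (U : {poly M}) :
  ip U (CDkernel n phi) = \sum_(k < n) ip U (Q k) *m gam k *m phi k.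
Proof.
rewrite (ip_sumr hW); apply: eq_bigr => k _; by rewrite (ip_Cr hW) mulmxA.
Qed.

End Orthogonality.

(** * Three-term recurrence and Christoffel-Darboux formula *)

Section RecurrenceAlgebra.
Local Set Implicit Arguments.
Local Unset Strict Implicit.
Context {R : realType} {N : nat}.
Local Notation C := R[i].
Local Notation M := 'M[C]_N.+1.

Lemma adj_recurrence0 (a p1 x g0 p0 : M) : a = p1 + x *m g0 *m p0 ->
  x ^t* = x -> g0 ^t* = g0 -> a ^t* = p1 ^t* + p0 ^t* *m (g0 *m x).
Proof. by move=> -> ex eg; rewrite adjmxD !adjmx_mul ex eg. Qed.

Lemma adj_recurrence (a p2 x g1 p1 h g0 p0 : M) :
  a = p2 + x *m g1 *m p1 + h *m g0 *m p0 ->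
  x ^t* = x -> g1 ^t* = g1 -> h ^t* = h -> g0 ^t* = g0 ->
  a ^t* = p2 ^t* + p1 ^t* *m (g1 *m x) + p0 ^t* *m (g0 *m h).
Proof. by move=> -> ex eg1 eh eg0; rewrite !adjmxD !adjmx_mul ex eg1 eh eg0. Qed.

(** Christoffel-Darboux for abstract sequences. The [hx] terms of the two recurrences cancel; as [g]
    and [h] are mutually inverse, the [h] terms become the boundary terms of the preceding index
    with opposite sign, and the sum telescopes. *)
Lemma telescope_recurrence (p q g hx h : nat -> M) (z s : C) n :
  z *: p 0%N = p 1%N + hx 0%N *m g 0%N *m p 0%N ->
  (forall k, z *: p k.+1 =
    p k.+2 + hx k.+1 *m g k.+1 *m p k.+1 + h k.+1 *m g k *m p k) ->
  s *: q 0%N = q 1%N + q 0%N *m (g 0%N *m hx 0%N) ->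
  (forall k, s *: q k.+1 =
    q k.+2 + q k.+1 *m (g k.+1 *m hx k.+1) + q k *m (g k *m h k.+1)) ->
  (forall k, g k *m h k = 1%:M) -> (forall k, h k *m g k = 1%:M) ->
  (z - s) *: (\sum_(k < n.+1) q k *m g k *m p k) =
  q n *m g n *m p n.+1 - q n.+1 *m g n *m p n.
Proof.
move=> p0 pS q0 qS gh hg.
have E k : (z - s) *: (q k *m g k *m p k) =
   q k *m g k *m (z *: p k) - (s *: q k) *m g k *m p k.
  by rewrite scalerBl -scalemxAr -!scalemxAl.
elim: n => [|n IH].
  rewrite big_ord_recl big_ord0 addr0 E p0 q0.
  by rewrite mulmxDr !mulmxDl !mulmxA opprD addrACA subrr addr0.
rewrite big_ord_recr scalerDr IH E pS qS.
rewrite !mulmxDr !mulmxDl !mulmxA.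
rewrite -(mulmxA _ (g n.+1) (h n.+1)) gh mulmx1.
rewrite -(mulmxA _ (h n.+1) (g n.+1)) hg mulmx1.
set a := q n.+1 *m g n.+1 *m p n.+2.
set b := _ *m hx n.+1 *m _ *m _.
set c := q n *m g n *m _.
set d := q n.+1 *m g n *m _.
set e := q n.+2 *m _ *m _.
rewrite !opprD; move: a b c d e => a b c d e.
rewrite [a + b + d + _]addrACA [a + b + _]addrACA subrr addr0.
by rewrite [LHS]addrC -[LHS]addrA -(opprB c d) addNr addr0.
Qed.

End RecurrenceAlgebra.

Section ChristoffelDarboux.
Local Set Implicit Arguments.
Local Unset Strict Implicit.
Context {R : realType} {N : nat}.
Local Notation C := R[i].
Local Notation M := 'M[C]_N.+1.
Variables (W : R -> 'M[R]_N.+1) (P : nat -> {poly M}).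
Hypotheses (hW : is_weight W) (hP : monic_OP W P).
Local Notation ip := (ip W).
Local Notation Q := (fun n => pstar (P n)).
Local Notation gam := (gam W P).
Local Notation h n := (ip (P n) (pstar (P n))).
Local Notation hX n := (ip ('X * P n) (pstar (P n))).

Lemma size_mulX (U : {poly M}) n : (size U <= n)%N -> (size ('X * U)%R <= n.+1)%N.
Proof.
move=> sU; apply/leq_sizeP => -[//|i] hi.
by rewrite coefXM /= nth_default // (leq_trans sU).
Qed.

Lemma size_sub_monic n (U V : {poly M}) : (size U <= n.+1)%N -> (size V <= n.+1)%N ->
  U`_n = V`_n -> (size (U - V)%R <= n)%N.
Proof.
move=> sU sV e; apply/leq_sizeP => i; rewrite leq_eqVlt => /predU1P [<-|hi].
  by rewrite coefB e subrr.
by rewrite coefB (nth_default _ (leq_trans sU hi)) (nth_default _ (leq_trans sV hi)) subrr.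
Qed.

Lemma sum_ord_last2 (V : nmodType) n (F : nat -> V) :
  (forall k, (k < n)%N -> F k = 0) -> \sum_(k < n.+2) F k = F n.+1 + F n.
Proof. by move=> F0; rewrite !big_ord_recr big1 /= ?add0r 1?addrC // => k _; exact: F0. Qed.

Lemma OP_recurrence_sum n : 'X * P n = P n.+1 +
  \sum_(k < n.+1) (ip ('X * P n) (Q k) *m gam k)%:P * P k.
Proof.
have s1 : (size ('X * P n)%R <= n.+2)%N by apply: size_mulX; rewrite (size_OP hP).
have s2 : (size (P n.+1) <= n.+2)%N by rewrite (size_OP hP).
have s3 : (size ('X * P n - P n.+1)%R <= n.+1)%N.
  by apply: size_sub_monic => //; rewrite coefXM /= !(coef_OP hP).
apply/eqP; rewrite addrC -subr_eq; apply/eqP.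
rewrite [LHS](OP_expansion hW hP s3); apply: eq_bigr => k _.
rewrite (ipBl hW) (ip_OP_neq hW hP) ?subr0 //.
by rewrite neq_ltn ltn_ord orbT.
Qed.

Lemma OP_recurrence0 : 'X * P 0%N = P 1%N + (hX 0 *m gam 0)%:P * P 0%N.
Proof.
by rewrite [LHS]OP_recurrence_sum big_ord_recl big_ord0 addr0.
Qed.

(* The coefficient of P_n is (int P_{n+1} W P_{n+1}^* ) gamma_n because
   x P_n and P_{n+1} differ by lower-order terms. *)
Lemma OP_recurrenceS n : 'X * P n.+1 = P n.+2 + (hX n.+1 *m gam n.+1)%:P * P n.+1
  + (h n.+1 *m gam n)%:P * P n.
Proof.
have s : (size ('X * Q n - Q n.+1)%R <= n.+1)%N.
  apply: size_sub_monic; first exact: size_mulX (size_pstar_OP hP n).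
    exact: (size_pstar_OP hP n.+1).
  by rewrite coefXM !coef_pstar !(coef_OP hP).
have E : ip ('X * P n.+1) (Q n) = h n.+1.
  rewrite [LHS]ipX.
  have e := ip_OPl hP s.
  rewrite (ipDr hW) in e.
  rewrite (ipNr hW) in e.
  by apply/eqP; rewrite -subr_eq0; apply/eqP.
rewrite [LHS]OP_recurrence_sum.
rewrite (sum_ord_last2 (F := fun k => (ip ('X * P n.+1) (Q k) *m gam k)%:P * P k)).
  by rewrite addrA E.
move=> k kn.
have e : ip ('X * P n.+1) (Q k) = 0.
  rewrite [LHS]ipX; apply: (ip_OPl hP).
  by apply: leq_trans (size_mulX (size_pstar_OP hP k)) _; rewrite !ltnS.
by rewrite e mul0mx polyC0 mul0r.
Qed.

Lemma hX_adj n : (hX n) ^t* = hX n.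
Proof.
rewrite (ip_adj hW) pstarK (ipX W); congr (ip _ _).
by apply/polyP => i; rewrite coef_pstar !coefXM; case: i => [|i] /=; rewrite ?adjmx0 ?coef_pstar.
Qed.

Lemma h_adj n : (h n) ^t* = h n.
Proof. by rewrite (ip_adj hW) pstarK. Qed.

Lemma gam_h n : gam n *m h n = 1%:M.
Proof. by rewrite (gamE W P) mulVmx // (ip_OP_unit hW hP). Qed.

Lemma h_gam n : h n *m gam n = 1%:M.
Proof. by rewrite (gamE W P) mulmxV // (ip_OP_unit hW hP). Qed.

Lemma peval_recS n z : z *: peval (P n.+1) z = peval (P n.+2) z
  + hX n.+1 *m gam n.+1 *m peval (P n.+1) z + h n.+1 *m gam n *m peval (P n) z.
Proof.
have e := congr1 (fun U => peval U z) (OP_recurrenceS n).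
rewrite peval_mulX !pevalD !peval_mulCl in e; exact: e.
Qed.

Lemma peval_rec0 z : z *: peval (P 0) z = peval (P 1) z
  + hX 0 *m gam 0 *m peval (P 0) z.
Proof.
have e := congr1 (fun U => peval U z) OP_recurrence0.
rewrite peval_mulX !pevalD !peval_mulCl in e; exact: e.
Qed.

Lemma peval_pstar_adj (U : {poly M}) s : peval (pstar U) s = (peval U (conjc s)) ^t*.
Proof. exact: peval_pstar. Qed.

Lemma peval_pstar_recS n s : s *: peval (Q n.+1) s = peval (Q n.+2) s
  + peval (Q n.+1) s *m (gam n.+1 *m hX n.+1) + peval (Q n) s *m (gam n *m h n.+1).
Proof.
rewrite 3!peval_pstar_adj -{1}(conjcK s) -adjmxZ.
apply: adj_recurrence (peval_recS n _) (hX_adj _) (gam_adj P hW _) (h_adj _) (gam_adj P hW _).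
Qed.

Lemma peval_pstar_rec0 s : s *: peval (Q 0) s = peval (Q 1) s
  + peval (Q 0) s *m (gam 0 *m hX 0).
Proof.
rewrite 2!peval_pstar_adj -{1}(conjcK s) -adjmxZ.
exact: adj_recurrence0 (peval_rec0 _) (hX_adj _) (gam_adj P hW _).
Qed.

Lemma christoffel_darboux n s z :
  (z - s) *: (\sum_(k < n.+1) peval (Q k) s *m gam k *m peval (P k) z) =
  peval (Q n) s *m gam n *m peval (P n.+1) z
  - peval (Q n.+1) s *m gam n *m peval (P n) z.
Proof.
apply: (telescope_recurrence (q := fun k => peval (Q k) s)
  (p := fun k => peval (P k) z) (hx := fun k => hX k) (h := fun k => h k)).
- exact: peval_rec0.
- by move=> k; exact: peval_recS.
- exact: peval_pstar_rec0.
- by move=> k; exact: peval_pstar_recS.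
- exact: gam_h.
- exact: h_gam.
Qed.

End ChristoffelDarboux.

(** * Integration by parts and the ladder identity *)

Section WeightedIntegrals.
Local Set Implicit Arguments.
Local Unset Strict Implicit.
Context {R : realType} {N : nat}.
Local Notation C := R[i].
Local Notation M := 'M[C]_N.+1.
Variables (W : R -> 'M[R]_N.+1) (hW : is_weight W).
Implicit Types (U V : {poly M}) (g : C -> C).

Definition wint g U V : M :=
  mxint (fun t : R => g t%:C *: (peval U t%:C *m to_cmx (W t) *m peval V t%:C)).

Lemma ip_wint U V : ip W U V = wint (fun=> 1) U V.
Proof. by congr mxint; apply/funext => t; rewrite scale1r. Qed.

Lemma wintDl g U1 U2 V : bholo g -> wint g (U1 + U2) V = wint g U1 V + wint g U2 V.
Proof.
move=> hg; rewrite /wint -mxintD; [|exact: mxintegrable_weight..].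
by congr mxint; apply/funext => t; rewrite pevalD !mulmxDl scalerDr.
Qed.

Lemma wint_Cl g (A : M) U V : bholo g -> wint g (A%:P * U) V = A *m wint g U V.
Proof.
move=> hg; rewrite /wint -mxint_mull; last exact: mxintegrable_weight.
by congr mxint; apply/funext => t; rewrite peval_mulCl -scalemxAr !mulmxA.
Qed.

Lemma wint_Cr g U V (A : M) : bholo g -> wint g U (V * A%:P) = wint g U V *m A.
Proof.
move=> hg; rewrite /wint -mxint_mulr; last exact: mxintegrable_weight.
by congr mxint; apply/funext => t; rewrite peval_mulCr -scalemxAl !mulmxA.
Qed.

Lemma wint0l g V : bholo g -> wint g 0 V = 0.
Proof.
by move=> hg; have /eqP := wintDl 0 0 V hg; rewrite addr0 addrC -subr_eq subrr => /eqP <-.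
Qed.

Lemma wintDr g U V1 V2 : bholo g -> wint g U (V1 + V2) = wint g U V1 + wint g U V2.
Proof.
move=> hg; rewrite /wint -mxintD; [|exact: mxintegrable_weight..].
by congr mxint; apply/funext => t; rewrite pevalD !mulmxDr scalerDr.
Qed.

Lemma wint0r g U : bholo g -> wint g U 0 = 0.
Proof.
by move=> hg; have := wint_Cr U 0 0 hg; rewrite mul0r mulmx0.
Qed.

Lemma wintNg g U V : bholo g -> wint (fun w => - g w) U V = - wint g U V.
Proof.
move=> hg; rewrite /wint -mxintN; last exact: mxintegrable_weight.
by congr mxint; apply/funext => t; rewrite scaleNr.
Qed.

Lemma wint_suml (I : Type) (r : seq I) (Q : pred I) (F : I -> {poly M}) g V : bholo g ->
  wint g (\sum_(i <- r | Q i) F i) V = \sum_(i <- r | Q i) wint g (F i) V.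
Proof.
move=> hg.
by elim/big_ind2: _ => // [|x1 x2 y1 y2 <- <-]; [exact: wint0l|exact: wintDl].
Qed.

Variables (G : {poly M}) (T : C -> M).
Hypothesis dT : forall z : C, mx_is_derive T z (peval G z *m T z).
Hypothesis WT : forall x : R, to_cmx (W x) = T x%:C *m (T x%:C) ^t*.

(** The extension of [W] to complex arguments. Its derivative is G S + S G^*, and on the real axis
    it agrees with [W]. *)
Let S (w : C) : M := T w *m fstar T w.
Let D g U V (w : C) : M := g w *: (peval U w *m S w *m peval V w).

Lemma fstar_real (F : C -> M) (t : R) : fstar F t%:C = (F t%:C) ^t*.
Proof. by rewrite /fstar (_ : Num.conj t%:C = t%:C) //; exact: conjc_real. Qed.

Lemma mx_is_derive_fstarT z : mx_is_derive (fstar T) z (fstar T z *m peval (pstar G) z).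
Proof.
apply: mx_is_derive_eq (mx_is_derive_fstar (dT (conjc z))) _.
by rewrite adjmx_mul peval_pstar.
Qed.

Let S_real (t : R) : S t%:C = to_cmx (W t).
Proof. by rewrite WT /S fstar_real. Qed.

Let derive_D g g' U V w : cderive g w (g' w) ->
  mx_is_derive (D g U V) w (D g' U V w + D g U^`() V w + D g (U * G) V w
    + D g U (pstar G * V) w + D g U V^`() w).
Proof.
move=> dg.
have dS := mx_is_deriveM (dT w) (mx_is_derive_fstarT w).
have dUS := mx_is_deriveM (mx_is_derive_peval U w) dS.
have dUSV := mx_is_deriveM dUS (mx_is_derive_peval V w).
apply: mx_is_derive_eq (mx_is_deriveZ dg dUSV) _.
rewrite /D /S !pevalM -!addrA; congr (_ + _).
by rewrite -!scalerDr; congr (_ *: _); rewrite !(mulmxDl, mulmxDr) !mulmxA -!addrA.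
Qed.

(** The integral over the line of the derivative of g U W V. The five terms come from [g], [U], the
    two factors of [W], and [V]; nothing remains at infinity. *)
Lemma wint_by_parts g g' U V : bholo g -> bholo g' ->
  (forall t : R, cderive g t%:C (g' t%:C)) ->
  wint g' U V + wint g U^`() V + wint g (U * G) V + wint g U (pstar G * V)
    + wint g U V^`() = 0.
Proof.
move=> hg hg' dg.
have iD f X Y : bholo f -> mxintegrable (fun t : R => D f X Y t%:C).
  move=> hf; have := mxintegrable_weight hW X Y hf.
  by congr mxintegrable; apply/funext => t; rewrite /D S_real.
have wD f X Y : wint f X Y = mxint (fun t : R => D f X Y t%:C).
  by congr mxint; apply/funext => t; rewrite /D S_real.
pose F' w := D g' U V w + D g U^`() V w + D g (U * G) V w
    + D g U (pstar G * V) w + D g U V^`() w.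
have iF' : mxintegrable (fun t : R => F' t%:C).
  by do 4!(apply: mxintegrableD; last exact: iD); exact: iD.
transitivity (mxint (fun t : R => F' t%:C)).
  rewrite /F' mxintD; [|do 3!(apply: mxintegrableD; last exact: iD); exact: iD|exact: iD].
  rewrite mxintD; [|do 2!(apply: mxintegrableD; last exact: iD); exact: iD|exact: iD].
  rewrite mxintD; [|do 1!(apply: mxintegrableD; last exact: iD); exact: iD|exact: iD].
  by rewrite mxintD; [rewrite -!wD|exact: iD|exact: iD].
apply: (mxint_derive (F := D g U V)).
- by move=> t; exact: derive_D.
- move=> t.
  (* Differentiability of [F'] gives its continuity. In the first summand the derivative of [g']
     comes from [bholo], in the others that of [g] is [g']. *)
  have [d hd] := hg'.1 t.
  eexists; repeat apply: mx_is_deriveD; try exact: derive_D.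
  exact: (derive_D (g' := fun=> d)).
- exact: iF'.
- apply: mxintegrableD; first exact: iD.
  (* The factor t is absorbed into the left polynomial, so t F' stays in the integrable class. *)
  have -> : (fun t : R => t%:C *: F' t%:C) = (fun t : R => D g' ('X * U) V t%:C
     + D g ('X * U^`()) V t%:C + D g ('X * (U * G)) V t%:C
     + D g ('X * U) (pstar G * V) t%:C + D g ('X * U) V^`() t%:C).
    apply/funext => t; rewrite /F' /D !scalerDr !peval_mulX.
    by rewrite -!scalemxAl !scalerA ![t%:C * _]mulrC.
  by do 4!(apply: mxintegrableD; last exact: iD); exact: iD.
Qed.

End WeightedIntegrals.

(** * Difference quotients of matrix polynomials *)

Section DifferenceQuotient.
Local Set Implicit Arguments.
Local Unset Strict Implicit.
Context {R : realType} {N : nat}.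
Local Notation C := R[i].
Local Notation M := 'M[C]_N.+1.
Implicit Types (Z : {poly M}) (z : C).

Lemma diffquot_exists Z z :
  exists q : {poly M}, Z - (peval Z z)%:P = q * ('X - (z%:M)%:P).
Proof.
apply/factor_theorem; rewrite /root hornerD hornerN hornerC.
by rewrite /peval subrr.
Qed.

Definition diffquot Z z : {poly M} := projT1 (cid (diffquot_exists Z z)).

Lemma diffquotE Z z : Z - (peval Z z)%:P = diffquot Z z * ('X - (z%:M)%:P).
Proof. exact: projT2 (cid (diffquot_exists Z z)). Qed.

(** One step of synthetic division by X - z, which determines the quotient from its top coefficient
    downwards. *)
Lemma coef_diffquot Z z i :
  (diffquot Z z)`_i = z *: (diffquot Z z)`_i.+1 + Z`_i.+1.
Proof.
have := congr1 (fun p : {poly M} => p`_i.+1) (diffquotE Z z).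
rewrite /= coefB coefC subr0 mulrBr coefB coefMX /= coefMC => ->.
by rewrite addrC -mul_mx_scalar subrK.
Qed.

Lemma size_diffquot n Z z : (size Z <= n.+1)%N -> (size (diffquot Z z) <= n)%N.
Proof.
move=> sZ.
have [->|q0] := eqVneq (diffquot Z z) 0; first by rewrite size_poly0.
have := size_Mmonic q0 (monicXsubC (z%:M)).
rewrite -diffquotE size_XsubC addn2 /= => e; rewrite -ltnS -e.
apply: (leq_trans (size_polyD _ _)); rewrite size_polyN geq_max sZ /=.
by rewrite (leq_trans (size_polyC_leq1 _)).
Qed.

Lemma peval_diffquot Z z t :
  (t - z) *: peval (diffquot Z z) t = peval Z t - peval Z z.
Proof.
have := congr1 (fun p => peval p t) (diffquotE Z z); rewrite /= pevalB pevalC => ->.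
rewrite pevalM pevalB pevalC pevalX -mul_mx_scalar; congr (_ *m _).
by apply/matrixP => i j; rewrite !mxE mulrnBl.
Qed.

End DifferenceQuotient.

(** * The identity common to both columns *)

Section LadderIdentity.
Local Set Implicit Arguments.
Local Unset Strict Implicit.
Context {R : realType} {N : nat}.
Local Notation C := R[i].
Local Notation M := 'M[C]_N.+1.
Variables (W : R -> 'M[R]_N.+1) (hW : is_weight W).
Variables (G : {poly M}) (T : C -> M).
Hypothesis dT : forall z : C, mx_is_derive T z (peval G z *m T z).
Hypothesis WT : forall x : R, to_cmx (W x) = T x%:C *m (T x%:C) ^t*.
Implicit Types (U V K : {poly M}) (z : C).

(* The integral H(U, V)(z) above. *)
Definition ladder z U V : M :=
  ip W (diffquot (U * G) z) (pstar V)
  + ip W U (pstar (diffquot (V * G) (conjc z))).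

Local Notation rho z := (fun w : C => (w - z)^-1).

(** The Cauchy integral without the factor 1/(2 pi i). Since the derivative of 1/(t - z) in z is its
    square, [dcau] is the derivative of [cau] in z. *)
Definition cau z U : M := wint W (fun w => (w - z)^-1) U 1.
Definition dcau z U : M := wint W (fun w => (w - z)^-1 * (w - z)^-1) U 1.

Lemma deriv1 : (1 : {poly M})^`() = 0.
Proof. by rewrite -polyC1 derivC. Qed.

Lemma bholo_resolvent_sqr z : complex.Im z != 0 -> bholo (fun w => (w - z)^-1 * (w - z)^-1).
Proof. by move=> z0; apply: bholoM; exact: bholo_resolvent. Qed.

Lemma eq_wintr g U V1 V2 : (forall s, peval V1 s = peval V2 s) ->
  wint W g U V1 = wint W g U V2.
Proof. by move=> e; congr mxint; apply/funext => t; rewrite e. Qed.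

Lemma peval1 z : peval 1 z = 1%:M :> M.
Proof. by rewrite -polyC1 pevalC. Qed.

Lemma by_parts_algebra (x a b c d e : M) :
  a = - x -> e = 0 -> a + b + c + d + e = 0 -> b + c + d = x.
Proof.
move=> -> -> /eqP; rewrite addr0 -!addrA addrC subr_eq0 !addrA => /eqP //.
Qed.

Lemma by_parts_algebra0 (a b c d e : M) :
  a = 0 -> a + b + c + d + e = 0 -> b + c + d + e = 0.
Proof. by move=> ->; rewrite add0r. Qed.

(** Integration by parts against 1/(t - z), whose derivative in t is minus its square. *)
Lemma cau_by_parts z U : complex.Im z != 0 ->
  cau z U^`() + wint W (rho z) (U * G) 1 + wint W (rho z) U (pstar G) = dcau z U.
Proof.
move=> z0; have hr := bholo_resolvent z0.
have hr2 := bholo_resolvent_sqr z0.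
have hn : bholo (fun w : C => - ((w - z)^-1 * (w - z)^-1)).
  have := bholoM (bholo_cst (-1)) hr2.
  by congr bholo; apply/funext => w; rewrite mulN1r.
have h := wint_by_parts hW dT WT U 1 hr hn.
have e4 : wint W (rho z) U (pstar G * 1) = wint W (rho z) U (pstar G).
  by apply: eq_wintr => s; rewrite pevalM peval1 mulmx1.
have e5 : wint W (rho z) U (1 : {poly M})^`() = 0.
  by rewrite deriv1; exact: wint0r.
rewrite e4 in h.
apply: by_parts_algebra (wintNg hW U 1 hr2) e5 (h _).
by move=> t; apply: cderive_resolvent; exact: real_sub_neq0.
Qed.

Lemma ip_by_parts U V :
  ip W U^`() V + ip W (U * G) V + ip W U (pstar G * V) + ip W U V^`() = 0.
Proof.
have h1 : bholo (fun=> 1 : C) := bholo_cst 1.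
have h0 : bholo (fun=> 0 : C) := bholo_cst 0.
have e : wint W (fun=> 0 : C) U V = 0.
  rewrite /wint -[RHS](mxint0 (R := R)); congr mxint; apply/funext => t.
  by rewrite scale0r.
rewrite !ip_wint.
exact: by_parts_algebra0 e (wint_by_parts hW dT WT U V h1 h0 (fun t => cderive_cst 1 t%:C)).
Qed.

Let mx1 U V := mxintegrable_weight hW U V (bholo_cst 1).

Lemma resolvent_split_algebra (A w B K : M) (t z e : C) : t - z != 0 ->
  (t - z)^-1 *: (A *m w *m (B *m (e%:M + (z - t) *: K))) =
  e *: ((t - z)^-1 *: (A *m w *m B)) - A *m w *m (B *m K).
Proof.
move=> a0; rewrite !mulmxDr mul_mx_scalar -!scalemxAr scalerDr; congr (_ + _).
  by rewrite !scalerA mulrC.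
by rewrite scalerA -[z - t]opprB mulrN mulVf ?scaleN1r.
Qed.

(** The factor z - s in [Y] cancels the pole of the resolvent, so that only the constant [eps]
    leaves a Cauchy integral behind. *)
Lemma wint_resolvent_split z U B Y (eps : C) K : complex.Im z != 0 ->
  (forall s, peval Y s = eps%:M + (z - s) *: peval K s) ->
  wint W (rho z) U (B * Y) = eps *: wint W (rho z) U B - ip W U (B * K).
Proof.
move=> z0 hY; have hr := bholo_resolvent z0; have mxi U' V' := mxintegrable_weight hW U' V' hr.
rewrite ip_wint /wint -mxintZ; last exact: mxi.
rewrite -mxintB; [|by apply: mxintegrableZ; exact: mxi|exact: mx1].
congr mxint; apply/funext => t; rewrite !pevalM hY scale1r.
by apply: resolvent_split_algebra; exact: real_sub_neq0.
Qed.

(** Off the axis the two terms of the difference quotient may be integrated separately, each over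
    the denominator t - z. *)
Lemma ip_diffquotl z Z Y : complex.Im z != 0 ->
  ip W (diffquot Z z) Y = wint W (rho z) Z Y - peval Z z *m wint W (rho z) 1 Y.
Proof.
move=> z0; have hr := bholo_resolvent z0; have mxi U' V' := mxintegrable_weight hW U' V' hr.
rewrite ip_wint /wint -mxint_mull; last exact: mxi.
rewrite -mxintB; [|exact: mxi|by apply: mxintegrable_mull; exact: mxi].
congr mxint; apply/funext => t; rewrite scale1r.
rewrite -[peval (diffquot Z z) _](scalerK (real_sub_neq0 t z0)) peval_diffquot.
rewrite peval1 mul1mx -!scalemxAl -scalemxAr -scalerBr.
by rewrite mulmxBl mulmxBl !mulmxA.
Qed.

(** The quotient is formed at conj z so that its [pstar] has denominator t - z. *)
Lemma ip_diffquotr z Z U : complex.Im z != 0 ->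
  ip W U (pstar (diffquot Z (conjc z))) =
  wint W (rho z) U (pstar Z) - wint W (rho z) U 1 *m peval (pstar Z) z.
Proof.
move=> z0; have hr := bholo_resolvent z0; have mxi U' V' := mxintegrable_weight hW U' V' hr.
rewrite ip_wint /wint -mxint_mulr; last exact: mxi.
rewrite -mxintB; [|exact: mxi|by apply: mxintegrable_mulr; exact: mxi].
congr mxint; apply/funext => t; rewrite scale1r.
rewrite -[peval (pstar (diffquot _ _)) _](scalerK (real_sub_neq0 t z0)).
have -> : (t%:C - z) *: peval (pstar (diffquot Z (conjc z))) t%:C
  = peval (pstar Z) t%:C - peval (pstar Z) z.
  rewrite !peval_pstar_adj -[t%:C - z]conjcK -adjmxZ -adjmxN -adjmxD.
  by rewrite (rmorphB (@conjc R)) peval_diffquot.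
rewrite peval1 mulmx1 -!scalemxAr -scalemxAl -scalerBr.
by rewrite mulmxBr.
Qed.

Lemma ladder_algebra (a1 a2 b1 b2 p1 p2 ugz ipK cau1 w1 iUGK w2 : M)
    (dU cU' cUG iGK iU'K iUK' : M) (eps : C) :
  a1 *m p1 + a2 *m p2 = ugz *m (ipK - eps *: cau1) + eps *: w1 - iUGK ->
  b1 *m p1 + b2 *m p2 = eps *: w2 - eps *: cUG - iGK ->
  cU' + w1 + w2 = dU -> iU'K + iUGK + iGK + iUK' = 0 ->
  (a1 + b1) *m p1 + (a2 + b2) *m p2 =
  ugz *m (ipK - eps *: cau1) + iU'K + iUK' + eps *: (dU - cU' - cUG).
Proof.
move=> e1 e2 <- /eqP e4; rewrite !mulmxDl addrACA e1 e2.
set X := ugz *m _.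
have {e4} -> : iU'K = - iUGK - iGK - iUK'.
  by apply/eqP; rewrite -subr_eq0 !opprD !opprK !addrA.
have -> : cU' + w1 + w2 - cU' = w1 + w2 by rewrite -[cU' + _ + _]addrA [LHS]addrC addKr.
rewrite -[X + _ + iUK']addrA subrK !scalerDr scalerN.
move: (eps *: w1) (eps *: w2) (eps *: cUG) => w1' w2' q'.
by rewrite addrACA [RHS]addrAC -!addrA.
Qed.

Lemma ip_comb X A B (p1 p2 : M) :
  ip W X A *m p1 + ip W X B *m p2 = ip W X (A * p1%:P + B * p2%:P).
Proof. by rewrite (ipDr hW) !(ip_Cr hW). Qed.

Lemma wint_comb g X A B (p1 p2 : M) : bholo g ->
  wint W g X A *m p1 + wint W g X B *m p2 = wint W g X (A * p1%:P + B * p2%:P).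
Proof. by move=> hg; rewrite (wintDr hW _ _ _ hg) !(wint_Cr hW _ _ _ hg). Qed.

Lemma diffquotl_algebra (d a u b w1 k1 c k2 : M) (e : C) :
  d = a - u *m b -> a = e *: w1 - k1 -> b = e *: c - k2 ->
  d = u *m (k2 - e *: c) + e *: w1 - k1.
Proof.
by move=> -> -> ->; rewrite -mulmxN opprB addrC -addrA.
Qed.

Lemma diffquotr_algebra (b1 b2 x1 x2 q v1 v2 p1 p2 w k g : M) (e : C) :
  b1 = x1 - q *m v1 -> b2 = x2 - q *m v2 ->
  x1 *m p1 + x2 *m p2 = e *: w - k ->
  v1 *m p1 + v2 *m p2 = g *m e%:M ->
  b1 *m p1 + b2 *m p2 = e *: w - e *: (q *m g) - k.
Proof.
move=> -> -> e1 e2; rewrite !mulmxBl addrACA e1 -opprD -!mulmxA -mulmxDr e2.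
by rewrite mulmxA mul_mx_scalar addrAC.
Qed.

(** Both halves of [ladder] are split at their difference quotients and recombined with [phi1] and
    [phi2]. Then [G] is removed from under the integrals, by [ip_by_parts] in the terms with [K] and
    by [cau_by_parts] in those with a resolvent; derivatives and values of [G] at z remain. *)
Lemma ladder_identity z U V1 V2 (phi1 phi2 : M) (eps : C) K : complex.Im z != 0 ->
  (forall s, peval (pstar V1) s *m phi1 + peval (pstar V2) s *m phi2 =
     eps%:M + (z - s) *: peval K s) ->
  ladder z U V1 *m phi1 + ladder z U V2 *m phi2 =
  peval (U * G) z *m (ip W 1 K - eps *: cau z 1) + ip W U^`() K + ip W U K^`()
  + eps *: (dcau z U - cau z U^`() - cau z U *m peval (pstar G) z).
Proof.
move=> z0 hphi; have hr := bholo_resolvent z0.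
pose Y := pstar V1 * phi1%:P + pstar V2 * phi2%:P.
have hY s : peval Y s = eps%:M + (z - s) *: peval K s.
  by rewrite pevalD !peval_mulCr hphi.
have wY Z : wint W (rho z) Z Y = eps *: wint W (rho z) Z 1 - ip W Z K.
  by have := wint_resolvent_split Z 1 z0 hY; rewrite !mul1r.
have peval_comb s : peval (pstar (V1 * G)) s *m phi1 + peval (pstar (V2 * G)) s *m phi2
    = peval (pstar G) s *m peval Y s.
  rewrite hY -hphi !peval_pstar_adj !pevalM.
  by rewrite !adjmx_mul mulmxDr !mulmxA.
apply: ladder_algebra (cau_by_parts U z0) (ip_by_parts U K).
  rewrite ip_comb; exact: diffquotl_algebra (ip_diffquotl (U * G) Y z0) (wY (U * G)) (wY 1).
apply: diffquotr_algebra (ip_diffquotr (V1 * G) U z0) (ip_diffquotr (V2 * G) U z0) _ _.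
  rewrite wint_comb // -(wint_resolvent_split U (pstar G) z0 hY).
  by apply: eq_wintr => s; rewrite pevalD !peval_mulCr peval_comb pevalM.
by rewrite peval_comb hY subrr scale0r addr0.
Qed.

End LadderIdentity.

(** * The polynomials A_n and B_n *)

Section DeltaCoefficients.
Local Set Implicit Arguments.
Local Unset Strict Implicit.
Context {R : realType} {N : nat}.
Local Notation C := R[i].
Local Notation M := 'M[C]_N.+1.

Lemma sum_ord_widen (V : nmodType) a b (F : nat -> V) : (a <= b)%N ->
  (forall i, (a <= i < b)%N -> F i = 0) -> \sum_(i < a) F i = \sum_(i < b) F i.
Proof.
move=> ab F0; rewrite -!(big_mkord xpredT F).
rewrite (big_cat_nat (n := a) (p := b)) //= [X in _ = _ + X]big_nat_cond.
rewrite [X in _ = _ + X]big1 ?addr0 //.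
by move=> i /andP [/F0].
Qed.

(** The convolution is indexed from the top coefficient of [U], as the truncations of P_n are. *)
Lemma coefM_top (U G : {poly M}) k r : (size U <= k.+1)%N ->
  (U * G)`_(k + r) = \sum_(a < k.+1) U`_(k - a) * G`_(r + a).
Proof.
move=> sU; rewrite coefM.
rewrite -(sum_ord_widen (F := fun i => U`_i * G`_(k + r - i)) (a := k.+1)).
- rewrite (reindex_inj rev_ord_inj) /=; apply: eq_bigr => a _.
  have ak : (a <= k)%N by rewrite -ltnS.
  by rewrite subSS; congr (_ * G`__); rewrite -{1}(subnK ak) -addnA addKn addnC.
- by rewrite ltnS leq_addr.
- by move=> i /andP [ki _]; rewrite nth_default ?mul0r // (leq_trans sU).
Qed.

Variables (P : nat -> {poly M}) (m : nat) (G : {poly M}).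
Hypothesis sG : (size G <= m.+1)%N.
Variables (k : nat) (z : C).
Hypothesis sP : size (P k) = k.+1.

(** The guard carries the convention a_{k,j} = 0 for j < 0, where truncated subtraction would return
    the constant coefficient. *)
Let pk a : M := if (a <= k)%N then (P k)`_(k - a) else 0.

Let PtruncE a : Ptrunc P k a z = \sum_(i < a.+1) z ^+ (a - i) *: pk i.
Proof.
rewrite /Ptrunc big_mkcond; apply: eq_bigr => i _.
by rewrite /pk; case: ifP => // _; rewrite scaler0.
Qed.

Let Ptrunc_rec a : Ptrunc P k a.+1 z = z *: Ptrunc P k a z + pk a.+1.
Proof.
rewrite !PtruncE big_ord_recr subnn expr0 scale1r; congr (_ + _).
rewrite scaler_sumr; apply: eq_bigr => i _.
by rewrite scalerA -exprS /= -subSn // -ltnS.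
Qed.

Let coefPG j : (j <= m)%N ->
  (P k * G)`_(k + (m - j)) = \sum_(a < j.+1) pk a * G`_(m - j + a).
Proof.
move=> jm; rewrite coefM_top ?sP //.
have G0 a : (j < a)%N -> G`_(m - j + a) = 0.
  by move=> ja; rewrite nth_default // (leq_trans sG) // -{1}(subnK jm) -addnS leq_add2l.
transitivity (\sum_(a < k.+1 + j.+1) pk a * G`_(m - j + a)).
  rewrite -(sum_ord_widen (F := fun a => pk a * G`_(m - j + a)) (a := k.+1)).
  - by apply: eq_bigr => a _; rewrite /pk -ltnS ltn_ord.
  - exact: leq_addr.
  - by move=> a /andP [ka _]; rewrite /pk leqNgt ka mul0r.
rewrite -(sum_ord_widen (F := fun a => pk a * G`_(m - j + a)) (a := j.+1)) //.
  exact: leq_addl.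
by move=> a /andP [ja _]; rewrite G0 ?mulr0.
Qed.

(** Both sides obey the same synthetic division from the top: passing from j to j + 1 multiplies by
    z and adds the next lower coefficient of P_k G, which collects the last terms of the
    truncations. *)
Lemma Delta_diffquot j : (j <= m)%N -> (j < k + m)%N ->
  Delta P m G j k z = (diffquot (P k * G) z)`_(k + m - j.+1).
Proof.
elim: j => [|j IH] jm jkm.
  have -> : Delta P m G 0 k z = pk 0 *m G`_m.
    rewrite /Delta big_ord_recl big_ord0 addr0 subn0 addn0; congr (_ *m _).
    by rewrite PtruncE big_ord_recl big_ord0 addr0 expr0 scale1r.
  rewrite coef_diffquot subn1 prednK //.
  (* P_k G has degree at most k + m, so its difference quotient has no coefficient at k + m. *)
  rewrite [(diffquot _ _)`__]nth_default ?scaler0 ?add0r; last first.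
    apply: size_diffquot; apply: (leq_trans (size_polyMleq _ _)).
    by rewrite sP /= -addnS leq_add2l.
  have := coefPG (leq0n m); rewrite subn0 => ->.
  by rewrite big_ord_recl big_ord0 addr0 addn0.
rewrite coef_diffquot.
have -> : (k + m - j.+2).+1 = (k + m - j.+1)%N by rewrite -subSn.
rewrite -IH 1?ltnW // -addnBA // coefPG //.
rewrite {1}/Delta big_ord_recl.
rewrite [in RHS]big_ord_recl /Delta scaler_sumr.
rewrite (eq_bigr (fun a : 'I_j.+1 => z *: (Ptrunc P k a z *m G`_(m - j + a))
   + pk a.+1 * G`_(m - j.+1 + a.+1))).
  rewrite big_split /= addrCA; congr (_ + (_ + _)).
  by rewrite PtruncE big_ord_recl big_ord0 addr0 expr0 scale1r.
move=> a _; rewrite lift0 Ptrunc_rec mulmxDl -scalemxAl; congr (_ *: (_ *m G`__) + _).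
by rewrite addnS -addSn -subSn.
Qed.

End DeltaCoefficients.

Section CoefficientsAsIntegrals.
Local Set Implicit Arguments.
Local Unset Strict Implicit.
Context {R : realType} {N : nat}.
Local Notation C := R[i].
Local Notation M := 'M[C]_N.+1.
Variables (W : R -> 'M[R]_N.+1) (P : nat -> {poly M}).
Hypotheses (hW : is_weight W) (hP : monic_OP W P).
Variables (m : nat) (G : {poly M}).
Hypothesis sG : (size G <= m.+1)%N.
Implicit Types z : C.

Lemma sum_ord_rev (V : nmodType) n (F : nat -> V) :
  \sum_(i < n) F i = \sum_(i < n) F (n - i.+1)%N.
Proof. by rewrite (reindex_inj rev_ord_inj). Qed.

Lemma pevalXn i z : peval ('X^i : {poly M}) z = (z ^+ i)%:M.
Proof. by rewrite /peval hornerXn scalar_mxX. Qed.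

(** For i < l the left-hand side is 0 by definition and the right-hand side by orthogonality, so the
    integral formula holds for every i. *)
Lemma bcoef_adj l i : (bcoef W P l i) ^t* = ip W 'X^i (pstar (P l)).
Proof.
rewrite /bcoef; case: leqP => li; last first.
  by rewrite adjmx0 (ip_OPr hW hP) // size_polyXn.
rewrite -[RHS]adjmxK (ip_adj hW) pstarK.
suff -> : mxint (fun t : R => t%:C ^+ i *: (peval (P l) t%:C *m to_cmx (W t)))
  = ip W (P l) (pstar 'X^i) by [].
congr mxint; apply/funext => t.
rewrite peval_pstar_real pevalXn -mul_mx_scalar; congr (_ *m _).
rewrite tr_scalar_mx map_scalar_mx; congr (_%:M).
rewrite -(rmorphXn (real_complex R)); exact/esym/conjc_real.
Qed.

Lemma bcoef_lt l i : (i < l)%N -> bcoef W P l i = 0.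
Proof. by move=> il; rewrite /bcoef leqNgt il. Qed.

Lemma ip_coef_expansion n (U V : {poly M}) : (size U <= n)%N ->
  ip W U V = \sum_(i < n) U`_i *m ip W 'X^i V.
Proof.
move=> sU; have e : U = \sum_(i < n) (U`_i)%:P * 'X^i.
  under eq_bigr do rewrite mul_polyC.
  rewrite -poly_def; apply/polyP => i; rewrite coef_poly.
  by case: ltnP => // ni; rewrite nth_default // (leq_trans sU).
by rewrite [in LHS]e (ip_suml hW); apply: eq_bigr => i _; rewrite (ip_Cl hW).
Qed.

(** The quotient has k + m coefficients, while the sums of A_n and B_n have J = m or J = m + 1
    terms. Missing or surplus terms carry some b_{l,i} with i < l and vanish. If J > k + m, the
    truncated index of a surplus term is 0, which lies below l because l > 0. *)
Lemma Delta_bcoef_sum l k J z : (J <= m.+1)%N -> (k + m <= l + J)%N ->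
  ((J <= k + m) || (0 < l))%N ->
  \sum_(j < J) Delta P m G j k z *m (bcoef W P l (k + m - j - 1)) ^t* =
  ip W (diffquot (P k * G) z) (pstar (P l)).
Proof.
move=> Jm kmJ hJ.
have sD : (size (diffquot (P k * G) z) <= k + m)%N.
  apply: size_diffquot; apply: (leq_trans (size_polyMleq _ _)).
  by rewrite (size_OP hP) /= -addnS leq_add2l.
rewrite (ip_coef_expansion _ sD).
rewrite (sum_ord_rev _ (fun i => (diffquot (P k * G) z)`_i *m ip W 'X^i (pstar (P l)))).
pose h j := (diffquot (P k * G) z)`_(k + m - j.+1) *m (bcoef W P l (k + m - j.+1)) ^t*.
transitivity (\sum_(j < k + m) h j); last first.
  apply: eq_bigr => j _; exact: (congr1 (mulmx _) (bcoef_adj l (k + m - j.+1))).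
transitivity (\sum_(j < J) h j).
  apply: eq_bigr => j _; rewrite /h -subnDA addn1.
  have [jkm|kmj] := ltnP j (k + m).
    by rewrite (Delta_diffquot sG z (size_OP hP k)) // -ltnS (leq_trans (ltn_ord j)).
  have l0 : (0 < l)%N.
    by case/orP: hJ => // hJ; move: (leq_trans (ltn_ord j) hJ); rewrite ltnNge kmj.
  have -> : (k + m - j.+1 = 0)%N by apply/eqP; rewrite subn_eq0 leqW.
  by rewrite bcoef_lt // adjmx0 !mulmx0.
have [Jkm|kmJ'] := leqP J (k + m).
  apply: sum_ord_widen => // j /andP [Jj jkm]; rewrite /h bcoef_lt ?adjmx0 ?mulmx0 //.
  by rewrite -subSn // subSS leq_subLR (leq_trans kmJ) // addnC leq_add2r.
apply/esym/sum_ord_widen; first exact: ltnW.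
move=> j /andP [kmj _]; rewrite /h bcoef_lt ?adjmx0 ?mulmx0 //.
have l0 : (0 < l)%N by case/orP: hJ => //; rewrite leqNgt kmJ'.
by rewrite (_ : (k + m - j.+1 = 0)%N) //; apply/eqP; rewrite subn_eq0 leqW.
Qed.

Lemma bcoef_Delta_sum l k J z : (J <= m.+1)%N -> (k + m <= l + J)%N ->
  ((J <= k + m) || (0 < l))%N ->
  \sum_(j < J) bcoef W P l (k + m - j - 1) *m fstar (Delta P m G j k) z =
  ip W (P l) (pstar (diffquot (P k * G) (conjc z))).
Proof.
move=> h1 h2 h3; rewrite -[RHS]adjmxK (ip_adj hW) pstarK -(Delta_bcoef_sum _ h1 h2 h3).
rewrite adjmx_sum; apply: eq_bigr => j _; by rewrite adjmx_mul adjmxK.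
Qed.

Lemma calA_ladder n z : calA W P m G n z = - gam W P n *m ladder W G z (P n) (P n).
Proof.
rewrite /calA big_split /= [X in _ *m X]addrC.
rewrite (@Delta_bcoef_sum n n m z) ?leqnSn ?leqnn ?leq_addl //.
by rewrite (@bcoef_Delta_sum n n m z) ?leqnSn ?leqnn ?leq_addl.
Qed.

Lemma calB_ladder n z : calB W P m G n.+1 z =
  - ladder W G z (P n.+1) (P n) *m gam W P n.
Proof.
rewrite /calB big_split /=.
rewrite (@Delta_bcoef_sum n n.+1 m.+1 z) ?addSn ?addnS ?leqnn ?ltnS ?leq_addl //.
(* The index (n + 1) + m - j - 2 equals n + m - j - 1, also in truncated subtraction. *)
rewrite (eq_bigr (fun j : 'I_m.+1 =>
  bcoef W P n.+1 (n + m - j - 1) *m fstar (Delta P m G j n) z)); last first.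
  by move=> j _; rewrite ?addSn -!subnDA addn2 addn1 subSS.
by rewrite (@bcoef_Delta_sum n.+1 n m.+1 z) ?orbT // addSn leqW // leq_add2l.
Qed.

End CoefficientsAsIntegrals.

(** * Cauchy integrals and the fundamental matrix T *)

Section CauchyDerivative.
Local Set Implicit Arguments.
Local Unset Strict Implicit.
Context {R : realType}.
Local Notation C := R[i].
Local Notation mu := (@lebesgue_measure R).

Lemma normc_le_ReIm (x : C) : `|x| <= (`|complex.Re x| + `|complex.Im x|)%:C.
Proof.
rewrite {1}(complexE x) (le_trans (ler_normD _ _)) // rmorphD /=.
rewrite normrM (_ : `|'i%C| = 1 :> C) ?mul1r; last first.
  by rewrite normc_def /= expr0n expr1n add0r sqrtr1.
by rewrite !normc_def /= expr0n !addr0 !sqrtr_sqr.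
Qed.

Lemma normV_le (x : C) (b : R) : 0 < b -> b%:C <= `|x| -> `|x^-1| <= (b^-1)%:C.
Proof.
move=> b0 hb; have x0 : 0 < `|x| by apply: lt_le_trans hb; rewrite ltcR.
rewrite normfV (fmorphV (real_complex R)) lef_pV2 // posrE //.
by rewrite ltcR.
Qed.

Definition cnorm1 (f : R -> C) : R :=
  \int[mu]_t `|complex.Re (f t)| + \int[mu]_t `|complex.Im (f t)|.

(** Real and imaginary parts are bounded separately, whence the factor 2. *)
Lemma cint_bound (g f : R -> C) (B : R) : (forall t, `|g t| <= B%:C) ->
  cintegrable f -> cintegrable (fun t => g t * f t) ->
  `|cint (fun t => g t * f t)| <= (2 * (B * cnorm1 f))%:C.
Proof.
move=> hg [fr fi] [hr hi].
have B0 : 0 <= B by rewrite -lecR; exact: le_trans (normr_ge0 _) (hg 0).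
have ir := integrable_norm fr; have ii := integrable_norm fi.
have key (u : R -> R) : mu.-integrable setT (EFin \o u) ->
    (forall t, `|u t| <= B * (`|complex.Re (f t)| + `|complex.Im (f t)|)) ->
    `|\int[mu]_t u t| <= B * cnorm1 f.
  move=> iu hu; apply: le_trans (le_normr_Rintegral _ iu) _ => //.
  rewrite /cnorm1 -RintegralD // -RintegralZl //; last exact: integrable_EFinD ir ii.
  apply: le_Rintegral => //; first exact: integrable_norm iu.
  by apply: integrable_EFinZl; exact: integrable_EFinD ir ii.
have hgf t : `|g t * f t| <= (B * (`|complex.Re (f t)| + `|complex.Im (f t)|))%:C.
  rewrite normrM (rmorphM (real_complex R)) ler_pM //; exact: normc_le_ReIm.
apply: le_trans (normc_le_ReIm _) _; rewrite lecR mulr2n mulrDl mul1r lerD //=.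
- by apply: key => // t; rewrite -lecR (le_trans (normc_ge_Re _)).
- by apply: key => // t; rewrite -lecR (le_trans (normc_ge_Im _)).
Qed.

(* 1/(a - h) - 1/a - h/a^2 = h^2 / (a^2 (a - h)), and |a - h| stays above
   |Im z| / 2. *)
Lemma cint_resolvent_derive (f : R -> C) (z : C) : complex.Im z != 0 ->
  (forall g, bholo g -> cintegrable (fun t : R => g t%:C * f t)) ->
  cderive (fun w => cint (fun t : R => (t%:C - w)^-1 * f t)) z
    (cint (fun t : R => ((t%:C - z)^-1 * (t%:C - z)^-1) * f t)).
Proof.
move=> z0 hf; apply/cderiveP => e e0.
have i1 : cintegrable f.
  have := hf _ (bholo_cst 1).
  by congr cintegrable; apply/funext => t; rewrite mul1r.
pose b : R := `|complex.Im z|.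
have b0 : 0 < b by rewrite normr_gt0.
pose B : R := b^-1 * b^-1 * (b / 2)^-1.
have B0 : 0 < B by rewrite !mulr_gt0 ?invr_gt0 ?mulr_gt0 ?invr_gt0.
pose K : R := 2 * (B * cnorm1 f).
have K0 : 0 <= K.
  by rewrite /K mulr_ge0 // mulr_ge0 ?(ltW B0) // /cnorm1 addr_ge0 // Rintegral_ge0.
have eE : e = (complex.Re e)%:C by rewrite RRe_real ?gtr0_real.
have e0' : 0 < complex.Re e by rewrite -ltcR -eE.
(* The first bound keeps |t - (h + z)| above b / 2 on the axis, so that [B] bounds the remainder
   kernel [g]; the second makes K |h| at most e, with K + 1 as a positive divisor. *)
pose r : R := Num.min (b / 2) (complex.Re e / (K + 1)).
have r0 : 0 < r by rewrite lt_min !divr_gt0 // ltr_wpDl.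
exists r%:C => [|h hr]; first by rewrite ltcR.
have nhE : `|h| = (complex.Re `|h|)%:C by rewrite RRe_real ?normr_real.
have hr' : complex.Re `|h| < r by rewrite -ltcR -nhE.
have [hb he] : complex.Re `|h| < b / 2 /\ complex.Re `|h| < complex.Re e / (K + 1).
  by move: hr'; rewrite lt_min => /andP.
have tz (t : R) : b%:C <= `|t%:C - z| := norm_real_sub_ge t z.
have tz0 (t : R) := real_sub_neq0 t z0.
have tzh (t : R) : (b / 2)%:C <= `|t%:C - (h + z)|.
  have -> : t%:C - (h + z) = (t%:C - z) - h by rewrite opprD addrCA addrC.
  apply: le_trans (lerB_dist _ _); rewrite lerBrDr.
  apply: le_trans (tz t); rewrite nhE -(rmorphD (real_complex R)) lecR.
  by move: hb; lra.
have hz0 : complex.Im (h + z) != 0.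
  apply/eqP => hz.
  have := tzh (complex.Re (h + z)).
  rewrite (_ : _ - (h + z) = 0) ?normr0 ?lecR; last first.
    by case: (h + z) hz => ? ? /= ->; rewrite subrr.
  by rewrite leNgt divr_gt0.
pose g (w : C) := (w - z)^-1 * (w - z)^-1 * (w - (h + z))^-1.
have bg : bholo g.
  by apply: bholoM; [exact: bholo_resolvent_sqr|exact: bholo_resolvent].
have bg1 : bholo (fun w => (w - z)^-1) := bholo_resolvent z0.
have bg2 := bholo_resolvent_sqr z0.
have E : cint (fun t : R => (t%:C - (h + z))^-1 * f t)
   = cint (fun t : R => (t%:C - z)^-1 * f t)
     + (h * cint (fun t : R => ((t%:C - z)^-1 * (t%:C - z)^-1) * f t)
     + h ^+ 2 * cint (fun t : R => g t%:C * f t)).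
  rewrite -!cintZ; [|exact: hf bg|exact: hf bg2].
  rewrite -cintD; [|apply: cintegrableZ; exact: hf bg2|apply: cintegrableZ; exact: hf bg].
  rewrite -cintD; [|exact: hf bg1|]; last first.
    by apply: cintegrableD; apply: cintegrableZ; [exact: hf bg2|exact: hf bg].
  congr cint; apply/funext => t; rewrite /g.
  rewrite !mulrA -!mulrDl; congr (_ * _).
  have := tz0 t; have : t%:C - (h + z) != 0 by exact: real_sub_neq0.
  move: (t%:C) => s h1 h2; field.
  by rewrite h1 h2.
rewrite E [_ + (_ + _)]addrC addrK [h * _ + _]addrC addrK normrM normrX.
have hB t : `|g t%:C| <= B%:C.
  rewrite /g /B 2!normrM 2!(rmorphM (real_complex R)).
  by rewrite !ler_pM ?mulr_ge0 ?normr_ge0 // normV_le ?divr_gt0.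
have := cint_bound hB i1 (hf _ bg); rewrite -/K => hK.
apply: (le_trans (ler_wpM2l _ hK)); first by rewrite exprn_ge0.
rewrite expr2 -mulrA mulrC ler_wpM2r //.
rewrite nhE -(rmorphM (real_complex R)) eE lecR.
have : complex.Re `|h| * (K + 1) < complex.Re e by rewrite -ltr_pdivlMr ?ltr_wpDl.
have : 0 <= complex.Re `|h| by rewrite -lecR -nhE; exact: normr_ge0.
by nra.
Qed.

End CauchyDerivative.

Section CauMatrix.
Local Set Implicit Arguments.
Local Unset Strict Implicit.
Context {R : realType} {N : nat}.
Local Notation C := R[i].
Local Notation M := 'M[C]_N.+1.
Variables (W : R -> 'M[R]_N.+1) (hW : is_weight W).

Lemma mx_is_derive_cau (U : {poly M}) z : complex.Im z != 0 ->
  mx_is_derive (fun w => cau W w U) z (dcau W z U).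
Proof.
move=> z0 i j.
pose f (t : R) := (peval U t%:C *m to_cmx (W t) *m peval 1 t%:C) i j.
have hf g : bholo g -> cintegrable (fun t : R => g t%:C * f t).
  move=> hg; have := mxintegrable_weight hW U 1 hg i j.
  by congr cintegrable; apply/funext => t; rewrite mxE.
have := cint_resolvent_derive z0 hf.
congr (is_derive _ _ _ _).
  apply/funext => w; rewrite mxE; congr cint.
  by apply/funext => t; rewrite mxE.
by rewrite mxE; congr cint; apply/funext => t; rewrite mxE.
Qed.

End CauMatrix.

(** * Derivative of the matrix inverse *)

Section HolomorphicInverse.
Local Set Implicit Arguments.
Local Unset Strict Implicit.
Context {R : realType}.
Local Notation C := R[i].

Lemma cderive_uniq (f : C -> C) z a b : cderive f z a -> cderive f z b -> a = b.
Proof.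
move=> ha hb; have [_ <-] := ha; have [_ <-] := hb; reflexivity.
Qed.

Lemma mx_is_derive_uniq p q (F : C -> 'M[C]_(p, q)) z A B :
  mx_is_derive F z A -> mx_is_derive F z B -> A = B.
Proof. by move=> hA hB; apply/matrixP => i j; exact: cderive_uniq (hA i j) (hB i j). Qed.

Definition cderivable (f : C -> C) z := exists d, cderive f z d.

Lemma cderivableM f g z : cderivable f z -> cderivable g z ->
  cderivable (fun w => f w * g w) z.
Proof. by move=> [a ha] [b hb]; eexists; exact: cderiveM ha hb. Qed.

Lemma cderivable_cst c z : cderivable (fun=> c) z.
Proof. by exists 0; exact: cderive_cst. Qed.

Lemma cderivable_sum (I : Type) (r : seq I) (Q : pred I) (f : I -> C -> C) z :
  (forall i, cderivable (f i) z) -> cderivable (fun w => \sum_(i <- r | Q i) f i w) z.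
Proof.
move=> hf; exists (\sum_(i <- r | Q i) projT1 (cid (hf i))).
by apply: cderive_sum => i; exact: projT2 (cid (hf i)).
Qed.

Lemma cderivable_prod (I : Type) (r : seq I) (f : I -> C -> C) z :
  (forall i, cderivable (f i) z) -> cderivable (fun w => \prod_(i <- r) f i w) z.
Proof.
move=> hf; elim: r => [|i r IH].
  rewrite (_ : (fun w => _) = fun=> 1); first exact: cderivable_cst.
  by apply/funext => w; rewrite big_nil.
rewrite (_ : (fun w => _) = fun w => f i w * \prod_(j <- r) f j w).
  exact: cderivableM.
by apply/funext => w; rewrite big_cons.
Qed.

Lemma cderivable_det n (F : C -> 'M[C]_n) z :
  (forall i j, cderivable (fun w => F w i j) z) -> cderivable (fun w => \det (F w)) z.
Proof.
move=> hF; apply: cderivable_sum => s; apply: cderivableM; first exact: cderivable_cst.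
exact: cderivable_prod.
Qed.

(** By Cramer's rule the entries of the inverse are cofactors divided by the determinant. *)
Lemma cderivable_invmx n (F : C -> 'M[C]_n) z :
  (forall w, F w \in unitmx) ->
  (forall i j, cderivable (fun w => F w i j) z) ->
  forall i j, cderivable (fun w => invmx (F w) i j) z.
Proof.
move=> uF hF i j.
rewrite (_ : (fun w => _) = fun w => (\det (F w))^-1 * cofactor (F w) j i); last first.
  by apply/funext => w; rewrite /invmx uF !mxE.
apply: cderivableM.
  have [d hd] := cderivable_det hF; eexists; apply: cderiveV hd.
  by have := uF z; rewrite unitmxE unitfE.
apply: cderivableM; first exact: cderivable_cst.
apply: cderivable_det => k l.
rewrite (_ : (fun w => _) = fun w => F w (lift j k) (lift i l)) //.
by apply/funext => w; rewrite !mxE.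
Qed.

(** The inverse being differentiable, differentiating F^-1 F = 1 forces the value of its
    derivative. *)
Lemma mx_is_derive_invmx n (F : C -> 'M[C]_n) z D :
  (forall w, F w \in unitmx) -> mx_is_derive F z D ->
  mx_is_derive (fun w => invmx (F w)) z (- (invmx (F z) *m D *m invmx (F z))).
Proof.
move=> uF dF.
have hF i j : cderivable (fun w => F w i j) z by exists (D i j); exact: dF.
pose E : 'M[C]_n := \matrix_(i, j) projT1 (cid (cderivable_invmx uF hF i j)).
have dE : mx_is_derive (fun w => invmx (F w)) z E.
  by move=> i j; rewrite mxE; exact: projT2 (cid (cderivable_invmx uF hF i j)).
have := mx_is_deriveM dE dF.
rewrite (_ : (fun w => _) = fun=> 1%:M); last by apply/funext => w; rewrite mulVmx.
move=> /mx_is_derive_uniq /(_ (mx_is_derive_cst _ _)) /eqP.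
rewrite addr_eq0 => /eqP e.
apply: mx_is_derive_eq dE _.
by rewrite -[E](mulmxK (uF z)) e mulNmx.
Qed.

Lemma cderive_affine (f : C -> C) (c k w d : C) : cderive f (c + k * w) d ->
  cderive (fun v => f (c + k * v)) w (k * d).
Proof.
move=> /cderiveP hf; apply/cderiveP => e e0.
have k1 : 0 < `|k| + 1 by rewrite ltr_wpDl.
have [|r r0 hr] := hf (e / (`|k| + 1)); first by rewrite divr_gt0.
exists (r / (`|k| + 1)) => [|h]; first by rewrite divr_gt0.
rewrite ltr_pdivlMr // => hh.
have kh : `|k * h| <= `|h| * (`|k| + 1) by rewrite normrM mulrC ler_wpM2l // lerDl.
have := hr (k * h) (le_lt_trans kh hh).
have -> : k * h + (c + k * w) = c + k * (h + w) by ring.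
have -> : k * h * d = h * (k * d) by ring.
move=> /le_trans; apply.
rewrite -mulrA ler_wpM2l ?(ltW e0) // mulrC ler_pdivrMr //.
Qed.

End HolomorphicInverse.

(** * Uniqueness for linear differential equations *)

Section LinearODE.
Local Set Implicit Arguments.
Local Unset Strict Implicit.
Context {R : realType} {N : nat}.
Local Notation C := R[i].
Local Notation M := 'M[C]_N.+1.

Lemma adjmxE p q (A : 'M[C]_(p, q)) i j : (A ^t*) i j = conjc (A j i).
Proof. by rewrite !mxE. Qed.

(** The product f(s) exp(-c s) is nonincreasing on [0, 1] and starts at 0, while f is
    nonnegative. *)
Lemma gronwall_eq0 (f f' : R -> R) (c : R) :
  (forall s, is_derive s (1 : R) f (f' s)) -> f 0 = 0 -> (forall s, 0 <= f s) ->
  (forall s, 0 <= s <= 1 -> f' s <= c * f s) -> f 1 = 0.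
Proof.
move=> df f00 f0 hf.
pose g s := f s * expR (- c * s).
pose g' s := (f' s - c * f s) * expR (- c * s).
have dg s : is_derive s (1 : R) g (g' s).
  have de : is_derive s (1 : R) (fun t => expR (- c * t)) (expR (- c * s) * - c).
    apply: (@is_derive1_comp _ expR (fun t => - c * t) s (expR (- c * s)) (- c)).
    have := @is_deriveM _ _ (fun=> - c) id s 1 0 1 (is_derive_cst _ _ _) (is_derive_id _ _).
    by move/is_derive_eq; apply; rewrite /GRing.scale /= mulr1 mulr0 addr0.
  have := is_deriveM (df s) de.
  move/is_derive_eq; apply; rewrite /g' /GRing.scale /=; ring.
have h : g 1 <= g 0.
  apply: (@ler0_derive1_le_cc R g 0 1); rewrite ?in_itv /= ?lexx ?ler01 //.
  - move=> s hs; rewrite derive1E (derive_val (df := g' s)).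
    rewrite /g' mulr_le0_ge0 ?expR_ge0 // subr_le0 hf //.
    by move: hs; rewrite in_itv /= => /andP [/ltW -> /ltW ->].
  - apply: continuous_subspaceT => s.
    exact/differentiable_continuous/derivable1_diffP.
apply/le_anti; rewrite f0 andbT -(pmulr_lle0 _ (expR_gt0 (- c * 1))).
by move: h; rewrite /g f00 mul0r.
Qed.

Lemma norm_peval_le (G : {poly M}) (z w : C) i j : `|w| <= `|z| ->
  `|peval G w i j| <= \sum_(k < size G) `|z| ^+ k * `|G`_k i j|.
Proof.
move=> wz; rewrite (peval_coef_wide _ (leqnn _)) summxE.
apply: (le_trans (ler_norm_sum _ _ _)); apply: ler_sum => k _.
by rewrite mxE normrM normrX ler_wpM2r // lerXn2r // nnegrE.
Qed.

(** Each |y_i| |y_j| is at most the mean of the two squares, hence at most the sum of all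
    squares. *)
Lemma norm_form_le (A : M) (y : 'cV[C]_N.+1) (K : 'I_N.+1 -> 'I_N.+1 -> C) :
  (forall i j, `|A i j| <= K i j) ->
  `|(y ^t* *m (A *m y)) ord0 ord0| <=
  (\sum_i \sum_j K i j) * \sum_i `|y i ord0| ^+ 2.
Proof.
move=> hK; rewrite mxE mulr_suml.
apply: (le_trans (ler_norm_sum _ _ _)); apply: ler_sum => i _.
rewrite [(A *m y) i ord0]mxE mulr_suml [X in `|X|]mulr_sumr.
apply: (le_trans (ler_norm_sum _ _ _)); apply: ler_sum => j _.
rewrite !mxE !normrM (normcJ (y i ord0)) mulrCA ler_pM ?mulr_ge0 //.
pose S := \sum_i0 `|y i0 ord0| ^+ 2.
have yS k : `|y k ord0| ^+ 2 <= S.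
  by rewrite /S (bigD1 k) //= lerDl sumr_ge0 // => l _; rewrite exprn_ge0.
rewrite -/S.
have [h _] := real_leif_mean_square (normr_real (y i ord0)) (normr_real (y j ord0)).
apply: (le_trans h); rewrite ler_pdivrMr // mulr_natr mulr2n; exact: lerD.
Qed.

(* Along the segment from z0 to 0, f = |y|^2 satisfies f' <= 2 k f. *)
Lemma ode_eq0 (G : {poly M}) (y : C -> 'cV[C]_N.+1) z0 :
  (forall z, mx_is_derive y z (peval G z *m y z)) -> y z0 = 0 -> y 0 = 0.
Proof.
move=> dy y0.
(* The segment from z0 at w = 0 to 0 at w = 1, with a complex parameter so that the complex
   derivative of [y] can be composed with it. *)
pose Y w := y (z0 + (- z0) * w).
pose A w : M := (- z0) *: peval G (z0 + (- z0) * w).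
have dY w : mx_is_derive Y w (A w *m Y w).
  move=> i j; rewrite -scalemxAl mxE.
  apply: (cderive_affine (f := fun v => y v i j)); exact: dy.
pose F w := fstar Y w *m Y w.
have Yr (s : R) : fstar Y s%:C = (Y s%:C) ^t*.
  by rewrite /fstar (_ : Num.conj s%:C = s%:C) //; exact: conjc_real.
have dF (s : R) : mx_is_derive F s%:C ((A s%:C *m Y s%:C) ^t* *m Y s%:C
     + (Y s%:C) ^t* *m (A s%:C *m Y s%:C)).
  rewrite -Yr; apply: mx_is_deriveM (dY _).
  by apply: mx_is_derive_fstar; rewrite conjc_real; exact: dY.
pose f (s : R) := complex.Re (F s%:C ord0 ord0).
have fE (s : R) : (f s)%:C = \sum_i `|Y s%:C i ord0| ^+ 2.
  have e : F s%:C ord0 ord0 = \sum_i `|Y s%:C i ord0| ^+ 2.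
    rewrite /F Yr mxE; apply: eq_bigr => i _.
    by rewrite !mxE sqr_normc mulrC.
  by rewrite /f e RRe_real // sum_real // => i _; rewrite rpredX // normr_real.
have f0 s : 0 <= f s.
  by rewrite -lecR fE sumr_ge0 // => i _; rewrite exprn_ge0.
(* On the segment the argument of [G] stays in the disc of radius |z0|, which bounds the matrix of
   the equation uniformly. *)
pose K i j := `|z0| * \sum_(k < size G) `|z0| ^+ k * `|G`_k i j|.
have AK (s : R) : 0 <= s <= 1 -> forall i j, `|A s%:C i j| <= K i j.
  move=> /andP [s0 s1] i j; rewrite mxE normrM normrN ler_wpM2l //.
  apply: norm_peval_le.
  rewrite (_ : z0 + - z0 * s%:C = z0 * (1 - s)%:C).
    rewrite normrM ler_piMr // normc_def /= expr0n addr0 sqrtr_sqr lecR.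
    by rewrite ger0_norm ?subr_ge0 // gerBl.
  by rewrite rmorphB /= mulrBr mulr1 mulNr.
pose k := complex.Re (\sum_i \sum_j K i j).
have kE : k%:C = \sum_i \sum_j K i j.
  rewrite RRe_real // sum_real // => i _; rewrite sum_real // => j _.
  by rewrite realM ?normr_real // sum_real // => l _;
    rewrite realM ?normr_real // rpredX // normr_real.
have f1 : f 1 = 0.
  apply: (@gronwall_eq0 f _ (2 * k) (fun s => is_derive_Re_restrict (dF s ord0 ord0))) => //.
    by rewrite /f /F /Y mulr0 addr0 y0 mulmx0 mxE.
  move=> s hs; have hB := norm_form_le (Y s%:C) (AK s hs).
  set D := A s%:C *m Y s%:C in hB *.
  (* The two terms of the derivative of |Y|^2 are conjugate; together they contribute twice the real
     part of one. *)
  rewrite mxE complex_ReD (_ : (D ^t* *m Y s%:C) ord0 ord0 = conjc (((Y s%:C) ^t* *m D) ord0 ord0)).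
    rewrite -kE -fE -(rmorphM (real_complex R)) in hB.
    have := le_trans (normc_ge_Re _) hB; rewrite lecR.
    move: (((Y s%:C) ^t* *m D) ord0 ord0) => [a b] /=.
    rewrite ler_norml => /andP [_ h]; rewrite -mulrA mulr2n mulrDl mul1r; exact: lerD.
  have e : D ^t* *m Y s%:C = ((Y s%:C) ^t* *m D) ^t* by rewrite [RHS]adjmx_mul adjmxK.
  by rewrite e adjmxE.
have : (f 1)%:C = 0 by rewrite f1.
rewrite fE => /eqP; rewrite psumr_eq0; last by move=> i _; rewrite exprn_ge0.
move=> /allP h; apply/colP => i; rewrite mxE.
have := h i (mem_index_enum _); rewrite sqrf_eq0 normr_eq0 => /eqP.
by rewrite /Y mulr1 subrr.
Qed.

End LinearODE.

(** * Invertibility of T and the block equations *)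

Section Ladder.
Local Set Implicit Arguments.
Local Unset Strict Implicit.
Context {R : realType} {N : nat}.
Local Notation C := R[i].
Local Notation M := 'M[C]_N.+1.
Variables (W : R -> 'M[R]_N.+1) (P : nat -> {poly M}).
Hypotheses (hW : is_weight W) (hP : monic_OP W P).
Variables (G : {poly M}) (T : C -> M).
Hypothesis dT : forall z : C, mx_is_derive T z (peval G z *m T z).
Hypothesis WT : forall x : R, to_cmx (W x) = T x%:C *m (T x%:C) ^t*.
Implicit Types (U Z : {poly M}) (z s : C).
Local Notation gam := (gam W P).

(* T 0 is invertible since T 0 (T 0)^* = W 0, and a vector killed by T z stays
   killed along the flow of y' = G y from z to 0. *)
Lemma fundamental_unit z : T z \in unitmx.
Proof.
rewrite unitmxE unitfE; apply/negP; rewrite -det_tr => /det0P [v v0 vT].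
pose y w := T w *m v^T.
have dy w : mx_is_derive y w (peval G w *m y w).
  apply: mx_is_derive_eq (mx_is_deriveM (dT w) (mx_is_derive_cst _ _)) _.
  by rewrite mulmx0 addr0 mulmxA.
have y0 : T 0 *m v^T = 0.
  by apply: (ode_eq0 dy (z0 := z)); rewrite /y -[LHS]trmxK trmx_mul trmxK vT trmx0.
have dT0 : \det (T 0) == 0.
  rewrite -det_tr; apply/det0P; exists v => //.
  by rewrite -[v]trmxK -trmx_mul y0 trmx0.
have : \det (to_cmx (W 0)) == 0 by rewrite WT det_mulmx mulf_eq0 (eqP dT0) eqxx.
move=> /det0P [u u0 uW].
have := (weight_form_ge0 hW 0 u).2; rewrite uW mul0mx mxE /= eqxx.
by rewrite (negbTE u0).
Qed.

Lemma fstar_fundamental_unit z : fstar T z \in unitmx.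
Proof. by rewrite /fstar map_unitmx unitmx_tr fundamental_unit. Qed.

(** V is differentiated into a diagonal polynomial matrix times V, so that V factors out of the
    equation for X on the right. *)
Lemma mx_is_derive_diag z :
  mx_is_derive (fun w => block_mx (T w) 0 0 (invmx (fstar T w))) z
   (block_mx (peval G z) 0 0 (- peval (pstar G) z) *m
    block_mx (T z) 0 0 (invmx (fstar T z))).
Proof.
rewrite mulmx_block !mulmx0 !mul0mx !addr0 !add0r.
apply: mx_is_derive_block; [exact: dT|exact: mx_is_derive_cst|exact: mx_is_derive_cst|].
apply: mx_is_derive_eq (mx_is_derive_invmx fstar_fundamental_unit (mx_is_derive_fstarT dT z)) _.
by rewrite mulmxA mulVmx ?fstar_fundamental_unit // mul1mx mulNmx.
Qed.

Lemma size_deriv_le n U : (size U <= n.+1)%N -> (size U^`() <= n)%N.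
Proof.
move=> sU; apply/leq_sizeP => i ni.
by rewrite coef_deriv nth_default ?mul0rn // (leq_trans sU).
Qed.

Lemma ip_CDkernel_peval n U z : (size U <= n)%N ->
  ip W U (CDkernel W P n (fun k => peval (P k) z)) = peval U z.
Proof.
move=> sU; rewrite (ip_CDkernel P hW) [in RHS](OP_expansion hW hP sU) peval_sum.
by apply: eq_bigr => k _; rewrite peval_mulCl.
Qed.

(** The reproducing property again, with evaluation at z replaced by another left-linear map, the
    Cauchy integral. *)
Lemma ip_CDkernel_cau n U z : complex.Im z != 0 -> (size U <= n)%N ->
  ip W U (CDkernel W P n (fun k => cau W z (P k))) = cau W z U.
Proof.
move=> z0 sU; have hr := bholo_resolvent z0.
rewrite (ip_CDkernel P hW) [in RHS](OP_expansion hW hP sU) /cau (wint_suml hW _ _ _ _ hr).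
by apply: eq_bigr => k _; rewrite (wint_Cl hW _ _ _ hr).
Qed.

Lemma peval_CDkernel n phi s : peval (CDkernel W P n phi) s =
  \sum_(k < n) peval (pstar (P k)) s *m gam k *m phi k.
Proof.
by rewrite peval_sum; apply: eq_bigr => k _; rewrite peval_mulCr mulmxA.
Qed.

(** Differentiation brings the degree of the kernel below n, hence below that of P_k. *)
Lemma ip_deriv_CDkernel n phi k : (n <= k)%N ->
  ip W (P k) (CDkernel W P n.+1 phi)^`() = 0.
Proof.
move=> nk; apply: (ip_OPl hP); apply: leq_trans nk.
by apply: size_deriv_le; exact: (size_CDkernel hP).
Qed.

Lemma size_OP_deriv n k : (k <= n.+1)%N -> (size (P k)^`() <= n.+1)%N.
Proof. by move=> kn; apply: size_deriv_le; rewrite (size_OP hP) ltnS. Qed.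

Lemma peval_ladder_algebra (l1 l2 p1 p2 ug i1 c iU' iUK' X d : M) :
  l1 *m p1 + l2 *m (- p2) = ug *m (i1 - 0%R *: c) + iU' + iUK' + (0 : C) *: X ->
  i1 = 1%:M -> iU' = d -> iUK' = 0 -> d + ug = l1 *m p1 - l2 *m p2.
Proof.
move=> e h1 h2 h3; move: e.
rewrite h1 h2 h3 !scale0r subr0 mulmx1 !addr0 mulmxN => ->; exact: addrC.
Qed.

(** Here [eps] = 0, and the kernel reproduces 1 and P_k'. For k = n and k = n + 1 both requirements
    are met: P_k' has degree at most n, and P_k is orthogonal to the derivative of the kernel. *)
Lemma ladder_peval n k z : complex.Im z != 0 -> (n <= k)%N -> (k <= n.+1)%N ->
  peval (P k)^`() z + peval (P k) z *m peval G z =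
  ladder W G z (P k) (P n) *m (gam n *m peval (P n.+1) z)
  - ladder W G z (P k) (P n.+1) *m (gam n *m peval (P n) z).
Proof.
move=> z0 nk kn; rewrite -pevalM.
pose K := CDkernel W P n.+1 (fun j => peval (P j) z).
have hK s : peval (pstar (P n)) s *m (gam n *m peval (P n.+1) z)
    + peval (pstar (P n.+1)) s *m (- (gam n *m peval (P n) z))
    = (0 : C)%:M + (z - s) *: peval K s.
  rewrite peval_CDkernel (christoffel_darboux hW hP) mulmxN !mulmxA.
  by rewrite -scalemx1 scale0r add0r.
have e := ladder_identity hW dT WT (P k) z0 hK.
apply: (peval_ladder_algebra e).
- by rewrite ip_CDkernel_peval ?peval1 // size_poly1.
- by rewrite ip_CDkernel_peval // size_OP_deriv.
- exact: ip_deriv_CDkernel.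
Qed.

(** From (t - s)/(t - z) = 1 + (z - s)/(t - z). *)
Lemma cau_shift Y Z z s : complex.Im z != 0 ->
  (forall t, peval Y t = (t - s) *: peval Z t) ->
  cau W z Y = ip W Z 1 + (z - s) *: cau W z Z.
Proof.
move=> z0 hY; have hr := bholo_resolvent z0.
rewrite ip_wint /cau /wint -mxintZ; last exact: (mxintegrable_weight hW _ _ hr).
rewrite -mxintD; [|exact: (mxintegrable_weight hW _ _ (bholo_cst 1))|
  by apply: mxintegrableZ; exact: (mxintegrable_weight hW _ _ hr)].
congr mxint; apply/funext => t; rewrite hY -!scalemxAl !scalerA -scalerDl; congr (_ *: _).
by have := real_sub_neq0 t z0; move: (t%:C) => x x0; field.
Qed.

(** The Cauchy integral of the Christoffel-Darboux formula in its second variable. The constant 1 is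
    the integral of the kernel against [W], to which only k = 0 contributes. *)
Lemma cau_christoffel_darboux n z s : complex.Im z != 0 ->
  peval (pstar (P n)) s *m gam n *m cau W z (P n.+1)
  - peval (pstar (P n.+1)) s *m gam n *m cau W z (P n) =
  1%:M + (z - s) *: \sum_(k < n.+1) peval (pstar (P k)) s *m gam k *m cau W z (P k).
Proof.
move=> z0; have hr := bholo_resolvent z0.
pose Z := \sum_(k < n.+1) (peval (pstar (P k)) s *m gam k)%:P * P k.
pose Y := (peval (pstar (P n)) s *m gam n)%:P * P n.+1
  + (- (peval (pstar (P n.+1)) s *m gam n))%:P * P n.
have hY t : peval Y t = (t - s) *: peval Z t.
  rewrite pevalD !peval_mulCl mulNmx -(christoffel_darboux hW hP) peval_sum.
  by congr (_ *: _); apply: eq_bigr => k _; rewrite peval_mulCl.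
have cZ : cau W z Z = \sum_(k < n.+1) peval (pstar (P k)) s *m gam k *m cau W z (P k).
  rewrite /cau (wint_suml hW _ _ _ _ hr).
  by apply: eq_bigr => k _; rewrite (wint_Cl hW _ _ _ hr).
have cY : cau W z Y = peval (pstar (P n)) s *m gam n *m cau W z (P n.+1)
  - peval (pstar (P n.+1)) s *m gam n *m cau W z (P n).
  by rewrite /cau (wintDl hW _ _ _ hr) !(wint_Cl hW _ _ _ hr) mulNmx.
have iZ : ip W Z 1 = 1%:M.
  rewrite (ip_suml hW) big_ord_recl (ip_Cl hW) big1 => [|k _]; last first.
    by rewrite (ip_Cl hW) (ip_OPl hP) ?mulmx0 // size_poly1.
  rewrite [LHS]addr0.
  have Q0 : pstar (P 0) = 1.
    apply/polyP => i; rewrite coef_pstar (OP0 hP) !coef1.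
    by case: i => [|i] /=; rewrite ?adjmx0 // trmx1 map_mx1.
  rewrite -[X in ip W _ X]Q0 -mulmxA (gam_h hW hP 0) mulmx1.
  by rewrite [X in peval X _]Q0 peval1.
by rewrite -cY (cau_shift z0 hY) iZ cZ.
Qed.

Lemma cau_ladder_algebra (l1 l2 p1 p2 ug i1 c iU' iUK' dq q' qG : M) :
  l1 *m p1 + l2 *m (- p2) = ug *m (i1 - (1 : C) *: c) + iU' + iUK' + (1 : C) *: (dq - q' - qG) ->
  i1 = c -> iU' = q' -> iUK' = 0 -> dq - qG = l1 *m p1 - l2 *m p2.
Proof.
move=> e h1 h2 h3; move: e; rewrite h1 h2 h3 !scale1r subrr mulmx0 add0r addr0 mulmxN => ->.
by rewrite [RHS]addrA [q' + _]addrC subrK.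
Qed.

(** Here [eps] = 1. Since the kernel reproduces Cauchy integrals, the pairing of 1 with [K] cancels
    the Cauchy integral of 1, which removes the term with P_k G at z, and the pairing of P_k'
    cancels the Cauchy integral of P_k'. *)
Lemma ladder_cau n k z : complex.Im z != 0 -> (n <= k)%N -> (k <= n.+1)%N ->
  dcau W z (P k) - cau W z (P k) *m peval (pstar G) z =
  ladder W G z (P k) (P n) *m (gam n *m cau W z (P n.+1))
  - ladder W G z (P k) (P n.+1) *m (gam n *m cau W z (P n)).
Proof.
move=> z0 nk kn.
pose K := CDkernel W P n.+1 (fun j => cau W z (P j)).
have hK s : peval (pstar (P n)) s *m (gam n *m cau W z (P n.+1))
    + peval (pstar (P n.+1)) s *m (- (gam n *m cau W z (P n)))
    = (1 : C)%:M + (z - s) *: peval K s.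
  by rewrite peval_CDkernel mulmxN !mulmxA cau_christoffel_darboux.
have e := ladder_identity hW dT WT (P k) z0 hK.
apply: (cau_ladder_algebra e).
- by rewrite ip_CDkernel_cau // size_poly1.
- by rewrite ip_CDkernel_cau // size_OP_deriv.
- exact: ip_deriv_CDkernel.
Qed.

Lemma cau_ladder0_algebra (l1 l2 ug i1 c iU' iUK' dq q' qG : M) :
  l1 *m 1%:M + l2 *m 0 = ug *m (i1 - (1 : C) *: c) + iU' + iUK' + (1 : C) *: (dq - q' - qG) ->
  i1 = 0 -> iU' = 0 -> iUK' = 0 -> q' = 0 -> dq - qG = ug *m c + l1.
Proof.
move=> e h1 h2 h3 h4; move: e; rewrite h1 h2 h3 h4.
rewrite !scale1r sub0r mulmxN !addr0 mulmx1 mulmx0 addr0 subr0 => ->.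
by rewrite addrA subrr add0r.
Qed.

(** The constant P_0 = 1 meets the hypothesis of [ladder_identity] with K = 0 and [eps] = 1. With no
    kernel to cancel it, the term with G(z) survives and accounts for the block -B_0 = G. *)
Lemma ladder_cau0 z : complex.Im z != 0 ->
  dcau W z (P 0) - cau W z (P 0) *m peval (pstar G) z =
  peval G z *m cau W z (P 0) + ladder W G z (P 0) (P 0).
Proof.
move=> z0.
have hK s : peval (pstar (P 0)) s *m 1%:M + peval (pstar (P 0)) s *m 0
    = (1 : C)%:M + (z - s) *: peval 0 s.
  rewrite mulmx1 mulmx0 addr0 {2}/peval horner0 scaler0 addr0.
  by rewrite peval_pstar_adj (OP0 hP) peval1 trmx1 map_mx1.
have e := ladder_identity hW dT WT (P 0) z0 hK.
have d0 : (P 0)^`() = 0 by rewrite (OP0 hP) deriv1.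
rewrite [P 0 * G](_ : _ = G) in e; last by rewrite (OP0 hP) mul1r.
rewrite -[X in _ *m (_ - _ *: cau W z X)](OP0 hP) in e.
apply: (cau_ladder0_algebra e).
- exact: (ip0r hW).
- by rewrite d0; exact: (ip0l hW).
- by rewrite derivC; exact: (ip0r hW).
- by rewrite d0 /cau (wint0l hW _ (bholo_resolvent z0)).
Qed.

End Ladder.

(** * The differential equation *)

Section Assembly.
Local Set Implicit Arguments.
Local Unset Strict Implicit.
Context {R : realType} {N : nat}.
Local Notation C := R[i].
Local Notation M := 'M[C]_N.+1.

Lemma eq_block_mx4 (a b c d a' b' c' d' : M) : a = a' -> b = b' -> c = c' -> d = d' ->
  block_mx a b c d = block_mx a' b' c' d'.
Proof. by move=> -> -> -> ->. Qed.

Lemma adj_sum_swap (a b a' b' : M) : a ^t* = b' -> b ^t* = a' -> (a + b) ^t* = a' + b'.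
Proof. by move=> <- <-; rewrite adjmxD addrC. Qed.

Lemma mul_block_diag (a b c d g h : M) :
  block_mx a b c d *m block_mx g 0 0 h = block_mx (a *m g) (b *m h) (c *m g) (d *m h).
Proof.
rewrite mulmx_block; apply: eq_block_mx4.
- by rewrite mulmx0 addr0.
- by rewrite mulmx0 add0r.
- by rewrite mulmx0 addr0.
- by rewrite mulmx0 add0r.
Qed.

(** The first and third equations give the upper row; the second and fourth, multiplied on the left
    by [ga], give the lower one. The powers of [c] in the two block matrices balance. *)
Lemma block_ladder (c : C) (p1 p0 q1 q0 dp1 dp0 dq1 dq0 g gs ga l10 l11 l00 l01 : M) :
  c != 0 ->
  dp1 + p1 *m g = l10 *m (ga *m p1) - l11 *m (ga *m p0) ->
  dp0 + p0 *m g = l00 *m (ga *m p1) - l01 *m (ga *m p0) ->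
  dq1 - q1 *m gs = l10 *m (ga *m q1) - l11 *m (ga *m q0) ->
  dq0 - q0 *m gs = l00 *m (ga *m q1) - l01 *m (ga *m q0) ->
  block_mx dp1 (c^-1 *: dq1) (- (c *: (ga *m dp0))) (- (c *: (ga *m (c^-1 *: dq0))))
  + block_mx p1 (c^-1 *: q1) (- (c *: (ga *m p0))) (- (c *: (ga *m (c^-1 *: q0))))
    *m block_mx g 0 0 (- gs) =
  block_mx (l10 *m ga) (c^-1 *: l11) (- (c *: (ga *m l00 *m ga))) (- (ga *m l01))
  *m block_mx p1 (c^-1 *: q1) (- (c *: (ga *m p0))) (- (c *: (ga *m (c^-1 *: q0)))).
Proof.
move=> c0 e1 e2 e3 e4.
rewrite mul_block_diag add_block_mx mulmx_block; apply: eq_block_mx4.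
- rewrite e1 mulmxN -scalemxAl -scalemxAr scalerA mulVf // scale1r.
  by rewrite !mulmxA.
- rewrite mulmxN -scalemxAl -scalerBr e3 -!scalemxAr !mulmxN -!scalemxAl -!scalemxAr.
  by rewrite scalerA divff // scale1r scalerBr !mulmxA.
- have -> : - (c *: (ga *m dp0)) + - (c *: (ga *m p0)) *m g = - (c *: (ga *m (dp0 + p0 *m g))).
    by rewrite mulNmx -scalemxAl -opprD -scalerDr -(mulmxA ga p0 g) -mulmxDr.
  rewrite e2 mulmxBr scalerBr opprB addrC !mulNmx mulmxN opprK.
  by rewrite -!scalemxAl -scalemxAr !mulmxA.
- have E x : c *: (ga *m (c^-1 *: x)) = ga *m x.
    by rewrite -scalemxAr scalerA divff // scale1r.
  rewrite !E mulmxN mulNmx opprK.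
  have -> : - (ga *m dq0) + ga *m q0 *m gs = - (ga *m (dq0 - q0 *m gs)).
    by rewrite mulmxBr opprB addrC mulmxA.
  rewrite e4 mulmxBr opprB addrC !mulNmx mulmxN opprK.
  by rewrite -scalemxAl -scalemxAr scalerA divff // scale1r !mulmxA.
Qed.

Lemma block_ladder0 (c : C) (q dq g gs l : M) : c != 0 ->
  dq - q *m gs = g *m q + l ->
  block_mx 0 (c^-1 *: dq) 0 0 + block_mx 1%:M (c^-1 *: q) 0 1%:M *m block_mx g 0 0 (- gs) =
  block_mx g (c^-1 *: l) 0 (- gs) *m block_mx 1%:M (c^-1 *: q) 0 1%:M.
Proof.
move=> c0 e; rewrite mul_block_diag add_block_mx mulmx_block; apply: eq_block_mx4.
- by rewrite mul1mx add0r mulmx1 mulmx0 addr0.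
- by rewrite mulmxN -scalemxAl -scalerBr e -scalemxAr mulmx1 -scalerDr.
- by rewrite !mul0mx mulmx0 !addr0.
- by rewrite mul1mx mul0mx mulmx1 add0r.
Qed.

Variables (W : R -> 'M[R]_N.+1) (P : nat -> {poly M}).
Hypotheses (hW : is_weight W) (hP : monic_OP W P).
Variables (m : nat) (G : {poly M}) (T : C -> M).
Hypothesis sG : (size G <= m.+1)%N.
Hypothesis dT : forall z : C, mx_is_derive T z (peval G z *m T z).
Hypothesis WT : forall x : R, to_cmx (W x) = T x%:C *m (T x%:C) ^t*.
Implicit Types z : C.
Local Notation gam := (gam W P).
Local Notation tpi := (@twopii R).

Lemma twopii_neq0 : tpi != 0.
Proof. by rewrite eq_complex /= eqxx /= mulf_neq0 // gt_eqF // pi_gt0. Qed.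

Lemma cauchy_cau z (U : {poly M}) :
  Defs.cauchy (fun t : R => peval U t%:C *m to_cmx (W t)) z = tpi^-1 *: cau W z U.
Proof.
have e : cau W z U =
    mxint (fun t : R => (t%:C - z)^-1 *: (peval U t%:C *m to_cmx (W t))).
  by rewrite /cau /wint; apply: eq_mxint => t; rewrite peval1 mulmx1.
by rewrite e.
Qed.

(** The adjoint exchanges the two halves of H. This turns B_n^* into an integral H with exchanged
    arguments. *)
Lemma ladder_adj z (U V : {poly M}) :
  (ladder W G (conjc z) U V) ^t* = ladder W G z V U.
Proof.
have zz : conjc (conjc z) = z := conjcK z.
rewrite /ladder zz.
apply: adj_sum_swap.
  by rewrite (ip_adj hW) (pstarK V).
by rewrite (ip_adj hW) (pstarK (diffquot _ _)).
Qed.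

Lemma fstar_calB n z : fstar (calB W P m G n.+1) z =
  - (gam n *m ladder W G z (P n) (P n.+1)).
Proof.
rewrite /fstar (calB_ladder hW hP sG) mulNmx adjmxN adjmx_mul (gam_adj P hW n).
by rewrite ladder_adj.
Qed.

Lemma invgam_calA n z : invmx (gam n) *m calA W P m G n z = - ladder W G z (P n) (P n).
Proof.
rewrite (calA_ladder hW hP sG) mulNmx mulmxN mulmxA mulVmx ?mul1mx //.
by rewrite (gamE W P) unitmx_inv (ip_OP_unit hW hP).
Qed.

Lemma FmxS n z : Fmx W P m G n.+1 z =
  block_mx (ladder W G z (P n.+1) (P n) *m gam n)
    (tpi^-1 *: ladder W G z (P n.+1) (P n.+1))
    (- (tpi *: (gam n *m ladder W G z (P n) (P n) *m gam n)))
    (- (gam n *m ladder W G z (P n) (P n.+1))).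
Proof.
rewrite /Fmx (calB_ladder hW hP sG) fstar_calB invgam_calA.
rewrite mulNmx opprK scalerN opprK /calAgam_pred (calA_ladder hW hP sG).
by rewrite !mulNmx scalerN.
Qed.

Lemma Fmx0 z : Fmx W P m G 0 z =
  block_mx (peval G z) (tpi^-1 *: ladder W G z (P 0) (P 0)) 0 (- peval (pstar G) z).
Proof.
rewrite /Fmx invgam_calA /calAgam_pred scaler0 scalerN !opprK; congr block_mx.
by rewrite /fstar /calB adjmxN peval_pstar_adj.
Qed.

Lemma YmxS n z : Ymx W P n.+1 z =
  block_mx (peval (P n.+1) z) (tpi^-1 *: cau W z (P n.+1))
   (- (tpi *: (gam n *m peval (P n) z))) (- (tpi *: (gam n *m (tpi^-1 *: cau W z (P n))))).
Proof. by rewrite /Ymx !cauchy_cau. Qed.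

Lemma Ymx0 z : Ymx W P 0 z = block_mx 1%:M (tpi^-1 *: cau W z (P 0)) 0 1%:M.
Proof.
have e : (fun t : R => peval (P 0) t%:C *m to_cmx (W t)) = fun t => to_cmx (W t).
  by apply/funext => t; rewrite (OP0 hP) peval1 mul1mx.
by rewrite /Ymx -cauchy_cau e.
Qed.

(** The equation for X with V split off on the right; the diagonal matrix is the logarithmic
    derivative of V. *)
Lemma Ymx_derive n z : complex.Im z != 0 -> exists2 dY,
  mx_is_derive (Ymx W P n) z dY &
  dY + Ymx W P n z *m block_mx (peval G z) 0 0 (- peval (pstar G) z) =
  Fmx W P m G n z *m Ymx W P n z.
Proof.
move=> z0; have dc k := mx_is_derive_cau hW (P k) z0.
case: n => [|n].
  exists (block_mx 0 (tpi^-1 *: dcau W z (P 0)) 0 0).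
    apply: (eq_mx_is_derive (fun w => esym (Ymx0 w))).
    apply: mx_is_derive_block; [exact: mx_is_derive_cst| |exact: mx_is_derive_cst..].
    exact: mx_is_deriveZl (dc 0).
  rewrite Ymx0 Fmx0; apply: block_ladder0 twopii_neq0 _.
  exact: (ladder_cau0 hW hP dT WT).
exists (block_mx (peval (P n.+1)^`() z) (tpi^-1 *: dcau W z (P n.+1))
   (- (tpi *: (gam n *m peval (P n)^`() z)))
   (- (tpi *: (gam n *m (tpi^-1 *: dcau W z (P n)))))).
  apply: (eq_mx_is_derive (fun w => esym (YmxS n w))).
  apply: mx_is_derive_block.
  - exact: mx_is_derive_peval.
  - exact: mx_is_deriveZl (dc _).
  - apply: mx_is_deriveN; apply: mx_is_deriveZl; apply: mx_is_derive_mull.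
    exact: mx_is_derive_peval.
  - apply: mx_is_deriveN; apply: mx_is_deriveZl; apply: mx_is_derive_mull.
    exact: mx_is_deriveZl (dc _).
rewrite YmxS FmxS; apply: block_ladder twopii_neq0 _ _ _ _.
- exact: (ladder_peval hW hP dT WT z0 (leqnSn n) (leqnn _)).
- exact: (ladder_peval hW hP dT WT z0 (leqnn n) (leqnSn _)).
- exact: (ladder_cau hW hP dT WT z0 (leqnSn n) (leqnn _)).
- exact: (ladder_cau hW hP dT WT z0 (leqnn n) (leqnSn _)).
Qed.

Lemma Xmx_derive n z : complex.Im z != 0 ->
  mx_is_derive (Xmx W P T n) z (Fmx W P m G n z *m Xmx W P T n z).
Proof.
move=> z0; have [dY hdY e] := Ymx_derive n z0.
apply: mx_is_derive_eq (mx_is_deriveM hdY (mx_is_derive_diag hW dT WT z)) _.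
by rewrite /Xmx !mulmxA -e mulmxDl -!mulmxA.
Qed.

End Assembly.

(** * Linearity in G *)

Section Linearity.
Local Set Implicit Arguments.
Local Unset Strict Implicit.
Context {R : realType} {N : nat}.
Local Notation C := R[i].
Local Notation M := 'M[C]_N.+1.
Variables (W : R -> 'M[R]_N.+1) (P : nat -> {poly M}).

Lemma fstarD p q (F1 F2 : C -> 'M[C]_(p, q)) z :
  fstar (fun w => F1 w + F2 w) z = fstar F1 z + fstar F2 z.
Proof. by rewrite /fstar adjmxD. Qed.

Lemma eq_fstar p q (F1 F2 : C -> 'M[C]_(p, q)) z :
  (forall w, F1 w = F2 w) -> fstar F1 z = fstar F2 z.
Proof. by move=> e; rewrite /fstar e. Qed.

Lemma DeltaD m (G1 G2 : {poly M}) j n z :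
  Delta P m (G1 + G2) j n z = Delta P m G1 j n z + Delta P m G2 j n z.
Proof. by rewrite -big_split; apply: eq_bigr => k _; rewrite coefD mulmxDr. Qed.

Lemma fstar_DeltaD m (G1 G2 : {poly M}) j n z :
  fstar (Delta P m (G1 + G2) j n) z =
  fstar (Delta P m G1 j n) z + fstar (Delta P m G2 j n) z.
Proof. by rewrite -fstarD; apply: eq_fstar => w; exact: DeltaD. Qed.

Lemma calAD m (G1 G2 : {poly M}) n z :
  calA W P m (G1 + G2) n z = calA W P m G1 n z + calA W P m G2 n z.
Proof.
rewrite /calA -mulmxDr -big_split; congr (_ *m _); apply: eq_bigr => j _.
by rewrite fstar_DeltaD DeltaD mulmxDr mulmxDl addrACA.
Qed.

Lemma calBD m (G1 G2 : {poly M}) n z :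
  calB W P m (G1 + G2) n z = calB W P m G1 n z + calB W P m G2 n z.
Proof.
case: n => [|n]; first by rewrite /calB pevalD opprD.
rewrite /calB -mulmxDl -opprD -big_split; congr (- _ *m _); apply: eq_bigr => j _.
by rewrite fstar_DeltaD DeltaD mulmxDr mulmxDl addrACA.
Qed.

Lemma calAgam_predD m (G1 G2 : {poly M}) n z :
  calAgam_pred W P m (G1 + G2) n z =
  calAgam_pred W P m G1 n z + calAgam_pred W P m G2 n z.
Proof.
by case: n => [|n]; rewrite /calAgam_pred; [rewrite addr0|rewrite calAD mulmxDl].
Qed.

Lemma FmxD m (G1 G2 : {poly M}) n z :
  Fmx W P m (G1 + G2) n z = Fmx W P m G1 n z + Fmx W P m G2 n z.
Proof.
rewrite /Fmx add_block_mx; apply: eq_block_mx4.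
- by rewrite calBD opprD.
- by rewrite calAD mulmxDr scalerDr opprD.
- by rewrite calAgam_predD scalerDr.
- by rewrite -fstarD; apply: eq_fstar => w; exact: calBD.
Qed.

Lemma Delta_lift0 m (G : {poly M}) n z : (size G <= m.+1)%N ->
  Delta P m.+1 G 0 n z = 0.
Proof.
move=> sG; rewrite /Delta big_ord_recl big_ord0 addr0 nth_default ?mulmx0 //.
by rewrite subn0 addn0.
Qed.

(** Raising the bound adds a vanishing top coefficient to [G], which shifts j by one. *)
Lemma Delta_liftS m (G : {poly M}) j n z : (size G <= m.+1)%N -> (j <= m)%N ->
  Delta P m.+1 G j.+1 n z = Delta P m G j n z.
Proof.
move=> sG jm; rewrite /Delta big_ord_recr /= [X in _ + X](_ : _ = 0) ?addr0.
  by apply: eq_bigr => k _; rewrite subSS.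
by rewrite nth_default ?mulmx0 // subSS addnS subnK.
Qed.

Lemma fstar_Delta_lift0 m (G : {poly M}) n z : (size G <= m.+1)%N ->
  fstar (Delta P m.+1 G 0 n) z = 0.
Proof. by move=> sG; rewrite /fstar Delta_lift0 // adjmx0. Qed.

Lemma fstar_Delta_liftS m (G : {poly M}) j n z : (size G <= m.+1)%N -> (j <= m)%N ->
  fstar (Delta P m.+1 G j.+1 n) z = fstar (Delta P m G j n) z.
Proof. by move=> sG jm; rewrite /fstar Delta_liftS. Qed.

Lemma sum_ord_shift (V : nmodType) m (F F' : nat -> V) : F 0%N = 0 ->
  (forall j, (j < m)%N -> F j.+1 = F' j) -> \sum_(j < m.+1) F j = \sum_(j < m) F' j.
Proof.
by move=> F0 FF; rewrite big_ord_recl F0 add0r; apply: eq_bigr => j _; exact: FF.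
Qed.

Lemma mulmx_add_eq0 (b x y c : M) : x = 0 -> y = 0 -> b *m x + y *m c = 0.
Proof. by move=> -> ->; rewrite mulmx0 mul0mx addr0. Qed.

Lemma calA_lift m (G : {poly M}) n z : (size G <= m.+1)%N ->
  calA W P m.+1 G n z = calA W P m G n z.
Proof.
move=> sG; rewrite /calA; apply: (congr1 (mulmx (- gam W P n))).
apply: (@sum_ord_shift _ m
  (fun j => bcoef W P n (n + m.+1 - j - 1) *m fstar (Delta P m.+1 G j n) z
     + Delta P m.+1 G j n z *m (bcoef W P n (n + m.+1 - j - 1)) ^t*)
  (fun j => bcoef W P n (n + m - j - 1) *m fstar (Delta P m G j n) z
     + Delta P m G j n z *m (bcoef W P n (n + m - j - 1)) ^t*)).
  apply: mulmx_add_eq0; [exact: fstar_Delta_lift0|exact: Delta_lift0].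
move=> j /ltnW jm.
by rewrite (Delta_liftS _ _ sG jm) (fstar_Delta_liftS _ _ sG jm) addnS subSS.
Qed.

Lemma calB_lift m (G : {poly M}) n z : (size G <= m.+1)%N ->
  calB W P m.+1 G n z = calB W P m G n z.
Proof.
move=> sG; case: n => [//|n]; rewrite /calB.
apply: (congr1 (fun X => - X *m gam W P n)).
apply: (@sum_ord_shift _ m.+1
  (fun j => Delta P m.+1 G j n.+1 z *m (bcoef W P n (n.+1 + m.+1 - j - 1)) ^t*
     + bcoef W P n.+1 (n.+1 + m.+1 - j - 2) *m fstar (Delta P m.+1 G j n) z)
  (fun j => Delta P m G j n.+1 z *m (bcoef W P n (n.+1 + m - j - 1)) ^t*
     + bcoef W P n.+1 (n.+1 + m - j - 2) *m fstar (Delta P m G j n) z)).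
  rewrite addrC; apply: mulmx_add_eq0; [exact: fstar_Delta_lift0|exact: Delta_lift0].
move=> j; rewrite ltnS => jm.
by rewrite (Delta_liftS _ _ sG jm) (fstar_Delta_liftS _ _ sG jm) addnS subSS.
Qed.

Lemma Fmx_lift m (G : {poly M}) n z : (size G <= m.+1)%N ->
  Fmx W P m.+1 G n z = Fmx W P m G n z.
Proof.
move=> sG; rewrite /Fmx; apply: eq_block_mx4.
- by rewrite (calB_lift _ _ sG).
- by rewrite (calA_lift _ _ sG).
- by case: n => [//|n]; rewrite /calAgam_pred (calA_lift _ _ sG).
- by apply: eq_fstar => w; exact: calB_lift.
Qed.

(** Additivity is termwise only for a common degree bound; this brings the three bounds of the
    theorem to one. *)
Lemma Fmx_widen m d (G : {poly M}) n z : (size G <= m.+1)%N ->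
  Fmx W P (m + d) G n z = Fmx W P m G n z.
Proof.
move=> sG; elim: d => [|d IH]; first by rewrite addn0.
rewrite (addnS m d); apply: etrans IH; apply: Fmx_lift.
by rewrite (leq_trans sG) // ltnS leq_addr.
Qed.

End Linearity.

Theorem theorem3p1 (R : realType) (N : nat)
    (W : R -> 'M[R]_N.+1)
    (P : nat -> {poly 'M[R[i]]_N.+1})
    (hW : is_weight W)
    (hP : monic_OP W P) :
  (forall (m : nat) (G : {poly 'M[R[i]]_N.+1}) (T : R[i] -> 'M[R[i]]_N.+1),
     (size G <= m.+1)%N ->
     (forall z : R[i], mx_is_derive T z (peval G z *m T z)) ->
     (forall x : R, to_cmx (W x) = T x%:C *m (T x%:C) ^t*) ->
     forall (n : nat) (z : R[i]), complex.Im z != 0 ->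
       mx_is_derive (Xmx W P T n) z (Fmx W P m G n z *m Xmx W P T n z))
  /\
  (forall (m m1 m2 : nat) (G1 G2 : {poly 'M[R[i]]_N.+1}),
     (size G1 <= m1.+1)%N -> (size G2 <= m2.+1)%N ->
     (size (G1 + G2)%R <= m.+1)%N ->
     forall (n : nat) (z : R[i]),
       Fmx W P m (G1 + G2) n z = Fmx W P m1 G1 n z + Fmx W P m2 G2 n z).
Proof.
split=> [m G T sG dT WT n z z0|m m1 m2 G1 G2 s1 s2 s12 n z].
  exact: (Xmx_derive hW hP sG dT WT).
(* The sum of the three bounds serves as the common one. *)
have e1 : (m1 + (m2 + m) = m + (m1 + m2))%N by rewrite addnA addnC.
have e2 : (m2 + (m + m1) = m + (m1 + m2))%N by rewrite addnC -addnA.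
apply: etrans (esym (Fmx_widen W P (m1 + m2) n z s12)) _.
apply: etrans (FmxD W P (m + (m1 + m2)) G1 G2 n z) _.
rewrite -{1}e1 -e2; apply: (congr2 +%R).
  exact: (Fmx_widen W P (m2 + m) n z s1).
exact: (Fmx_widen W P (m + m1) n z s2).
Qed.
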